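(* Let $\Gamma$ be the $\mathbb{Z}_3^3$-grading on the Albert algebra $\mathcal{A}$ over an algebraically closed field $\mathbb{F}$ of characteristic different from $2$ and $3$, as defined in the context. Then $W(\Gamma)$ is the commutator subgroup of $\mathrm{Aut}(\mathbb{Z}_3^3)$, i.e., $W(\Gamma)\cong SL_3(3)$.
   Context: Gradings and Weyl groups. For a grading $\Gamma:\mathcal{A}=\bigoplus_{g\in G}\mathcal{A}_g$ of a (nonassociative) algebra by an abelian group $G$ ($\mathcal{A}_g\mathcal{A}_h\subset\mathcal{A}_{g+h}$, additive notation), $\mathrm{Supp}\,\Gamma=\{g:\mathcal{A}_g\neq0\}$; $\mathrm{Aut}(\Gamma)$ is the group of algebra automorphisms of $\mathcal{A}$ permuting the nonzero components $\mathcal{A}_g$; $\mathrm{Stab}(\Gamma)$ is the subgroup of those leaving each component invariant; the Weyl group is $W(\Gamma)=\mathrm{Aut}(\Gamma)/\mathrm{Stab}(\Gamma)$. When $G$ is the universal abelian group of $\Gamma$ (i.e., for any realization of the same decomposition as a grading by an abelian group $H$ there is a unique homomorphism $G\to H$ restricting to the identity on the support), each $\varphi\in\mathrm{Aut}(\Gamma)$ induces a unique automorphism $u$ of $G$ with $\varphi(\mathcal{A}_s)=\mathcal{A}_{u(s)}$ for all $s\in\mathrm{Supp}\,\Gamma$, and in this way $W(\Gamma)$ is regarded as a subgroup of $\mathrm{Aut}(G)$. Cayley algebra. $\mathcal{C}$ is the $8$-dimensional algebra over $\mathbb{F}$ with basis $\{e_1,e_2,u_1,u_2,u_3,v_1,v_2,v_3\}$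 and multiplication, indices of $u,v$ taken modulo $3$: $e_1^2=e_1$, $e_2^2=e_2$, $e_1e_2=e_2e_1=0$; $e_1u_i=u_i=u_ie_2$, $e_2v_i=v_i=v_ie_1$, $e_2u_i=u_ie_1=e_1v_i=v_ie_2=0$; $u_iv_i=-e_1$, $v_iu_i=-e_2$, $u_iv_j=v_iu_j=0$ for $i\ne j$; $u_i^2=v_i^2=0$; $u_iu_{i+1}=-u_{i+1}u_i=v_{i+2}$, $v_iv_{i+1}=-v_{i+1}v_i=u_{i+2}$. Its norm $n$ is the multiplicative quadratic form with polar form $n(x,y)=n(x+y)-n(x)-n(y)$, where all basis elements are isotropic, $n(e_1,e_2)=n(u_i,v_i)=1$, and all other pairs of distinct basis elements are orthogonal; $\bar x=n(x,1)1-x$. Albert algebra. $\mathcal{A}$ is the algebra of Hermitian $3\times3$ matrices $\begin{pmatrix}\alpha_1&\bar a_3&a_2\\ a_3&\alpha_2&\bar a_1\\ \bar a_2&a_1&\alpha_3\end{pmatrix}$ ($\alpha_i\in\mathbb{F}$, $a_i\in\mathcal{C}$) with product $XY=\frac12(X\cdot Y+Y\cdot X)$, where $X\cdot Y$ is the usual matrix product. $E_i$ denotes the matrix with $\alpha_i=1$ and all other parameters $0$; $\iota_i(a)$ denotes the matrix with $a_i=2a$ and all other parameters $0$. So $\mathcal{A}=\bigoplus_{i=1}^3(\mathbb{F}E_i\oplus\iota_i(\mathcal{C}))$, the $E_i$ are orthogonal idempotents with sum $1$, and (indices modulo 3) $E_i\iota_i(a)=0$, $E_{i+1}\iota_i(a)=\frac12\iota_i(a)=E_{i+2}\iota_i(a)$,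 $\iota_i(a)\iota_{i+1}(b)=\iota_{i+2}(\bar a\bar b)$, $\iota_i(a)\iota_i(b)=2n(a,b)(E_{i+1}+E_{i+2})$. The $\mathbb{Z}_3^3$-grading on $\mathcal{A}$. Let $\tau$ be the order $3$ automorphism of $\mathcal{C}$ with $e_j\mapsto e_j$ ($j=1,2$), $u_i\mapsto u_{i+1}$, $v_i\mapsto v_{i+1}$ (indices modulo 3), and define on $\mathcal{C}$ the new product $x*y=\tau(\bar x)\tau^2(\bar y)$ (the Okubo algebra). Let $\omega\in\mathbb{F}$ be a fixed primitive third root of unity. There are unique automorphisms $\varphi_1,\varphi_2$ of $(\mathcal{C},* )$ with $\varphi_1(e_1)=\omega e_1$, $\varphi_1(u_1)=u_1$, $\varphi_2(e_1)=e_1$, $\varphi_2(u_1)=\omega u_1$; they commute and have order $3$. Put $\tilde\iota_i(x)=\iota_i(\tau^i(x))$ for $x\in\mathcal{C}$, $i=1,2,3$. Extend $\varphi_j$ ($j=1,2$) to automorphisms of $\mathcal{A}$ by $\varphi_j(E_i)=E_i$, $\varphi_j(\tilde\iota_i(x))=\tilde\iota_i(\varphi_j(x))$, and define the automorphism $\varphi_3$ of $\mathcal{A}$ by $\varphi_3(E_i)=E_{i+1}$, $\varphi_3(\tilde\iota_i(x))=\tilde\iota_{i+1}(x)$ (indices modulo 3). The automorphisms $\varphi_1,\varphi_2,\varphi_3$ of $\mathcal{A}$ commute and have order $3$. The grading $\Gamma:\mathcal{A}=\bigoplus_{g\in\mathbb{Z}_3^3}\mathcal{A}_g$ is their simultaneous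 eigenspace decomposition: $\mathcal{A}_{(\bar k_1,\bar k_2,\bar k_3)}=\{X\in\mathcal{A}:\varphi_i(X)=\omega^{k_i}X,\ i=1,2,3\}$. All components are one-dimensional, and the universal abelian group of $\Gamma$ is $\mathbb{Z}_3^3$. *)

(* Defs.v *)
From HB Require Import structures.
From mathcomp Require Import all_boot all_order all_algebra all_fingroup all_solvable.
From mathcomp Require Import boolp ring.

Set Implicit Arguments.
Unset Strict Implicit.
Unset Printing Implicit Defensive.

Import GRing.Theory.
Local Open Scope ring_scope.

(* The algebras below are nonassociative: an algebra is a vector space together
   with a product [mul : V -> V -> V].                                        *)

Section Gradings.

Variables (F : fieldType) (V : vectType F) (mul : V -> V -> V).

(* V has finite dimension: a linear endomorphism is bijective iff its kernel
   is 0.                                                                      *)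
Definition alg_aut (phi : 'End(V)) : Prop :=
  lker phi = 0%VS /\ forall x y, phi (mul x y) = mul (phi x) (phi y).

Variables (G : finZmodType) (Gam : G -> {vspace V}).

Definition gr_supp : {set G} := [set g | Gam g != 0%VS].

(* Aut(Gamma) *)
Definition gr_aut (phi : 'End(V)) : Prop :=
  [/\ alg_aut phi,
      forall s, s \in gr_supp ->
        exists2 t, t \in gr_supp & (phi @: Gam s)%VS = Gam t
    & forall t, t \in gr_supp ->
        exists2 s, s \in gr_supp & (phi @: Gam s)%VS = Gam t].

(* Stab(Gamma) *)
Definition gr_stab (phi : 'End(V)) : Prop :=
  alg_aut phi /\ forall g, (phi @: Gam g)%VS = Gam g.

Definition induces (phi : 'End(V)) (u : {perm G}) : Prop :=
  forall s, s \in gr_supp -> (phi @: Gam s)%VS = Gam (u s).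

(* W(Gamma), regarded as a subgroup of Aut(G).  By [induces_stab] and
   [induces_comp], this is Aut(Gamma) / Stab(Gamma) as soon as each phi in
   Aut(Gamma) induces a unique u in Aut(G).                                   *)
Definition weyl : {set {perm G}} :=
  [set u in Aut [set: G] | `[< exists2 phi, gr_aut phi & induces phi u >]].

Lemma induces_stab phi : gr_aut phi -> induces phi 1%g <-> gr_stab phi.
Proof.
move=> [aut_phi _ _]; split=> [ind | [_ stab] s _]; last by rewrite perm1.
split=> // g; have [Gg0|] := eqVneq (Gam g) 0%VS; first by rewrite Gg0 limg0.
by move=> Gg; rewrite ind ?inE // perm1.
Qed.

Lemma induces_comp phi psi u v : gr_aut phi ->
  induces phi u -> induces psi v -> induces (psi \o phi)%VF (u * v)%g.
Proof.
move=> [_ permt _] indu indv s ss; rewrite limg_comp indu // permM indv //.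
by have [t ts eqt] := permt s ss; rewrite inE -indu // eqt; rewrite inE in ts.
Qed.

End Gradings.

(* Indices modulo 3 are elements of the ring 'Z_3 = 'I_3; the index 3 is 0.   *)

Section Cayley.

Variable F : fieldType.

(* (a, b, x, y) stands for a e1 + b e2 + \sum_i x_i u_i + \sum_i y_i v_i.     *)
Definition cayley : vectType F := (F^o * F^o * 'rV[F]_3 * 'rV[F]_3)%type.

Definition ce1 : cayley := (1, 0, 0, 0).
Definition ce2 : cayley := (0, 1, 0, 0).
Definition cu (i : 'I_3) : cayley := (0, 0, delta_mx 0 i, 0).
Definition cv (i : 'I_3) : cayley := (0, 0, 0, delta_mx 0 i).
Definition cone : cayley := ce1 + ce2.

Definition dot (x y : 'rV[F]_3) : F := \sum_i x 0 i * y 0 i.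
Definition cross (x y : 'rV[F]_3) : 'rV[F]_3 :=
  \row_i (x 0 (i + 1) * y 0 (i + 2%:R) - x 0 (i + 2%:R) * y 0 (i + 1)).

(* The bilinear extension of the multiplication table of the basis e1, e2,
   u_i, v_i, which is recovered in [cmul_ee] to [cmul_succ] below.            *)
Definition cmul (p q : cayley) : cayley :=
  let: (a, b, x, y) := p in let: (a', b', x', y') := q in
  (a * a' - dot x y',
   b * b' - dot y x',
   a *: x' + b' *: x + cross y y',
   b *: y' + a' *: y + cross x x').

Definition cnorm (p : cayley) : F :=
  let: (a, b, x, y) := p in a * b + dot x y.
Definition cpolar (p q : cayley) : F := cnorm (p + q) - cnorm p - cnorm q.
Definition cconj (p : cayley) : cayley := cpolar p cone *: cone - p.

(* u_i |-> u_(i+1) and v_i |-> v_(i+1) on coordinates *)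
Definition ctau (p : cayley) : cayley :=
  let: (a, b, x, y) := p in
  (a, b, \row_i x 0 (i - 1), \row_i y 0 (i - 1)).

Definition okubo (p q : cayley) : cayley :=
  cmul (ctau (cconj p)) (ctau (ctau (cconj q))).

End Cayley.

Arguments ce1 {F}.
Arguments ce2 {F}.
Arguments cone {F}.
Arguments cu {F}.
Arguments cv {F}.

Section Albert.

Variable F : fieldType.
Local Notation C := (cayley F).

(* (alpha, a) stands for the Hermitian matrix [hmx (alpha, a)].               *)
Definition albert : vectType F := ('rV[F]_3 * {ffun 'I_3 -> C})%type.

(* Entries: (i, i) is alpha_i, (i+1, i) is a_(i+2), (i, i+1) is its conjugate. *)
Definition hmx (X : albert) (i j : 'I_3) : C :=
  if i == j then X.1 0 i *: cone
  else if i == j + 1 then X.2 (j + 2%:R)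
  else cconj (X.2 (i + 2%:R)).

(* Reads (alpha, a) off a Hermitian matrix. *)
Definition hmx_coord (M : 'I_3 -> 'I_3 -> C) : albert :=
  (\row_i (M i i).1.1.1, [ffun i : 'I_3 => M (i + 2%:R) (i + 1)]).

Definition hmx_mul (M N : 'I_3 -> 'I_3 -> C) (i j : 'I_3) : C :=
  \sum_k cmul (M i k) (N k j).

Definition hmx_jordan (M N : 'I_3 -> 'I_3 -> C) (i j : 'I_3) : C :=
  2%:R^-1 *: (hmx_mul M N i j + hmx_mul N M i j).

(* [hmx] turns this product into [hmx_jordan]: see [hmx_albert_mul].          *)
Definition albert_mul (X Y : albert) : albert :=
  hmx_coord (hmx_jordan (hmx X) (hmx Y)).

Definition aE (i : 'I_3) : albert := (delta_mx 0 i, 0).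
Definition aiota (i : 'I_3) (x : C) : albert :=
  (0, [ffun j => if j == i then 2%:R *: x else 0]).
(* Since ctau ^ 3 = 1, the index 3 may be represented by 0 here as well.      *)
Definition aiotat (i : 'I_3) (x : C) : albert := aiota i (iter i (@ctau F) x).

(* The linear map with E_i |-> E_i and iotat_i(x) |-> iotat_i(phi(x)): see
   [albert_extE] and [albert_ext_iotat].                                      *)
Definition albert_ext_fun (phi : 'End(C)) (X : albert) : albert :=
  (X.1, [ffun i : 'I_3 =>
           iter i (@ctau F) (phi (iter (3 - i) (@ctau F) (X.2 i)))]).
Definition albert_ext (phi : 'End(C)) : 'End(albert) :=
  linfun (albert_ext_fun phi).

(* The linear map with E_i |-> E_(i+1) and iotat_i(x) |-> iotat_(i+1)(x): see
   [albert_shiftE] and [albert_shift_iotat].                                  *)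
Definition albert_shift_fun (X : albert) : albert :=
  (\row_i X.1 0 (i - 1), [ffun i : 'I_3 => ctau (X.2 (i - 1))]).
Definition albert_shift : 'End(albert) := linfun albert_shift_fun.

(* phi_1 and phi_2; each condition has exactly one solution, see
   [okubo_phi1_unique] and [okubo_phi2_unique]. The element u_1 is [cu 1].    *)
Definition is_okubo_phi1 (w : F) (phi : 'End(C)) : Prop :=
  [/\ alg_aut (@okubo F) phi, phi ce1 = w *: ce1 & phi (cu 1) = cu 1].
Definition is_okubo_phi2 (w : F) (phi : 'End(C)) : Prop :=
  [/\ alg_aut (@okubo F) phi, phi ce1 = ce1 & phi (cu 1) = w *: cu 1].

Definition eigenvspace (phi : 'End(albert)) (a : F) : {vspace albert} :=
  lker (phi - a *: \1%VF).

(* The coordinates k_1, k_2, k_3 of k are k 0 0, k 0 1, k 0 2. *)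
Definition albert_grading (w : F) (phi1 phi2 : 'End(C)) (k : 'rV['Z_3]_3) :
    {vspace albert} :=
  let: A1 := eigenvspace (albert_ext phi1) (w ^+ k 0 0) in
  let: A2 := eigenvspace (albert_ext phi2) (w ^+ k 0 1) in
  let: A3 := eigenvspace albert_shift (w ^+ k 0 2%:R) in
  (A1 :&: A2 :&: A3)%VS.

End Albert.

Definition SL3_3 : {set {'GL_3['F_3]}} := [set g | \det (GLval g) == 1].

Section Checks.

Variable F : fieldType.
Local Notation C := (cayley F).

Lemma ord3P (P : 'I_3 -> Prop) : P 0 -> P 1 -> P 2%:R -> forall i, P i.
Proof.
move=> P0 P1 P2 [[|[|[|//]]] lti].
- by have -> : Ordinal lti = 0 by apply: val_inj.
- by have -> : Ordinal lti = 1 by apply: val_inj.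
- by have -> : Ordinal lti = 2%:R by apply: val_inj.
Qed.

Lemma sum3 (V : nmodType) (f : 'I_3 -> V) : \sum_i f i = f 0 + f 1 + f 2%:R.
Proof.
rewrite !big_ord_recl big_ord0 addr0 addrA.
by congr (f _ + f _ + f _); apply: val_inj.
Qed.

Fact o11 : 1 + 1 = 2%:R :> 'I_3. Proof. exact: val_inj. Qed.
Fact o12 : 1 + 2%:R = 0 :> 'I_3. Proof. exact: val_inj. Qed.
Fact o21 : 2%:R + 1 = 0 :> 'I_3. Proof. exact: val_inj. Qed.
Fact o22 : 2%:R + 2%:R = 1 :> 'I_3. Proof. exact: val_inj. Qed.
Fact oN0 : 0 - 1 = 2%:R :> 'I_3. Proof. exact: val_inj. Qed.
Fact oN1 : 1 - 1 = 0 :> 'I_3. Proof. exact: val_inj. Qed.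
Fact oN2 : 2%:R - 1 = 1 :> 'I_3. Proof. exact: val_inj. Qed.
Fact e01 : (0 == 1 :> 'I_3) = false. Proof. by []. Qed.
Fact e10 : (1 == 0 :> 'I_3) = false. Proof. by []. Qed.
Fact e02 : (0 == 2%:R :> 'I_3) = false. Proof. by []. Qed.
Fact e20 : (2%:R == 0 :> 'I_3) = false. Proof. by []. Qed.
Fact e12 : (1 == 2%:R :> 'I_3) = false. Proof. by []. Qed.
Fact e21 : (2%:R == 1 :> 'I_3) = false. Proof. by []. Qed.

Lemma cayleyP (p q : C) : p.1.1.1 = q.1.1.1 -> p.1.1.2 = q.1.1.2 ->
  (forall i, p.1.2 0 i = q.1.2 0 i) -> (forall i, p.2 0 i = q.2 0 i) -> p = q.
Proof.
case: p q => [[[a b] x] y] [[[a' b'] x'] y'] /= -> -> xx yy.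
by congr (_, _, _, _); apply/rowP.
Qed.

Definition o3E := (o11,o12,o21,o22,oN0,oN1,oN2,e01,e10,e02,e20,e12,e21, @add0r 'I_3, eqxx).

Local Ltac cay :=
  apply: cayleyP => /=; rewrite ?/dot ?/cross ?sum3;
  try (apply: ord3P); rewrite ?mxE ?o3E /= ?mxE ?o3E /=; rewrite /GRing.scale/=; try ring.

Lemma cmul_ee : [/\ cmul ce1 ce1 = ce1 :> C, cmul ce2 ce2 = ce2 :> C,
  cmul ce1 ce2 = 0 :> C & cmul ce2 ce1 = 0 :> C].
Proof. split; cay. Qed.

Lemma cmul_eu i : [/\ cmul ce1 (cu i) = cu i :> C, cmul (cu i) ce2 = cu i :> C,
  cmul ce2 (cu i) = 0 :> C & cmul (cu i) ce1 = 0 :> C].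
Proof. elim/ord3P: i;  split; cay. Qed.

Lemma cmul_ev i : [/\ cmul ce2 (cv i) = cv i :> C, cmul (cv i) ce1 = cv i :> C,
  cmul ce1 (cv i) = 0 :> C & cmul (cv i) ce2 = 0 :> C].
Proof. elim/ord3P: i;  split; cay. Qed.

Lemma cmul_uv i j : cmul (cu i) (cv j) = (if i == j then - ce1 else 0) :> C.
Proof. elim/ord3P: i; elim/ord3P: j;  rewrite !o3E; cay. Qed.

Lemma cmul_vu i j : cmul (cv i) (cu j) = (if i == j then - ce2 else 0) :> C.
Proof. elim/ord3P: i; elim/ord3P: j;  rewrite !o3E; cay. Qed.

Lemma cmul_sqr i : cmul (cu i) (cu i) = 0 :> C /\ cmul (cv i) (cv i) = 0 :> C.
Proof. elim/ord3P: i;  split; cay. Qed.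

Lemma cmul_succ i :
  [/\ cmul (cu i) (cu (i + 1)) = cv (i + 2%:R) :> C,
      cmul (cu (i + 1)) (cu i) = - cv (i + 2%:R) :> C,
      cmul (cv i) (cv (i + 1)) = cu (i + 2%:R) :> C
    & cmul (cv (i + 1)) (cv i) = - cu (i + 2%:R) :> C].
Proof. elim/ord3P: i;  rewrite !o3E; split; cay. Qed.

Lemma cnorm_basis i : [/\ cnorm (ce1 : C) = 0, cnorm (ce2 : C) = 0,
  cnorm (cu i : C) = 0 & cnorm (cv i : C) = 0].
Proof. elim/ord3P: i; rewrite /cnorm /= /dot !sum3 !mxE !o3E; split; ring. Qed.

Lemma cpolarE (p q : C) : cpolar p q =
  p.1.1.1 * q.1.1.2 + p.1.1.2 * q.1.1.1 + dot p.1.2 q.2 + dot q.1.2 p.2.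
Proof.
case: p q => [[[a b] x] y] [[[a' b'] x'] y'] /=.
rewrite /cpolar /cnorm /= /dot !sum3 !mxE. ring.
Qed.

Lemma cconjE (p : C) : cconj p = (p.1.1.2, p.1.1.1, - p.1.2, - p.2).
Proof.
rewrite /cconj cpolarE.
case: p => [[[a b] x] y]; apply: cayleyP=> /=; rewrite /dot !sum3 !mxE;
 try (move=> i; rewrite !mxE); rewrite /GRing.scale /=; ring.
Qed.

Lemma ctauE : [/\ ctau ce1 = ce1 :> C, ctau ce2 = ce2 :> C,
  forall i, ctau (cu i) = cu (i + 1) :> C & forall i, ctau (cv i) = cv (i + 1) :> C].
Proof.
by split; try elim/ord3P; cay.
Qed.

Lemma ctau3 p : ctau (ctau (ctau p)) = p :> C.
Proof. case: p => [[[a b] x] y]; cay; by rewrite !o3E. Qed.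

Lemma cconjK (p : C) : cconj (cconj p) = p.
Proof. by rewrite !cconjE /= !opprK; case: p => [[[]]]. Qed.

Lemma cconjB (p q : C) : cconj (p + q) = cconj p + cconj q.
Proof. rewrite !cconjE. case: p q => [[[a b] x] y] [[[a' b'] x'] y'].
by congr (_, _, _, _); rewrite /= opprD. Qed.

Lemma cconjZ k (p : C) : cconj (k *: p) = k *: cconj p.
Proof. rewrite !cconjE. case: p  => [[[a b] x] y].
by congr (_, _, _, _); rewrite /= scalerN. Qed.

Lemma cconjM (p q : C) : cconj (cmul p q) = cmul (cconj q) (cconj p).
Proof.
rewrite !cconjE; case: p q => [[[a b] x] y] [[[a' b'] x'] y'] /=.
by apply: cayleyP => /=; rewrite ?/dot ?/cross ?sum3;
  try (apply: ord3P); rewrite ?mxE /=; rewrite ?mxE; rewrite /GRing.scale/=; ring.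
Qed.

Lemma cconj1 : cconj cone = cone :> C.
Proof. by rewrite cconjE; apply: cayleyP => /= *; rewrite ?mxE; ring. Qed.

Lemma cmulD p q q' : cmul p (q + q') = cmul p q + cmul p q' :> C.
Proof.
case: p q q' => [[[a b] x] y] [[[a' b'] x'] y'] [[[a'' b''] x''] y''] /=.
by apply: cayleyP => /=; rewrite ?/dot ?/cross ?sum3;
  try (apply: ord3P); rewrite ?mxE /=; rewrite ?mxE; rewrite /GRing.scale/=; ring.
Qed.

Lemma hmxC X i j : hmx X j i = cconj (hmx X i j) :> C.
Proof.
elim/ord3P: i; elim/ord3P: j; rewrite /hmx !o3E //= ?cconjK //;
 by rewrite cconjZ cconj1.
Qed.

Lemma jordanC X Y i j : hmx_jordan (hmx X) (hmx Y) j i =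
  cconj (hmx_jordan (hmx X) (hmx Y) i j) :> C.
Proof.
rewrite /hmx_jordan cconjZ cconjB addrC /hmx_mul !sum3 !cconjB !cconjM.
by rewrite -!hmxC.
Qed.

Lemma cmul_conj p q : cmul p (cconj q) + cmul q (cconj p) = cpolar p q *: cone :> C.
Proof.
rewrite !cconjE cpolarE; case: p q => [[[a b] x] y] [[[a' b'] x'] y'] /=.
by apply: cayleyP => /=; rewrite ?/dot ?/cross ?sum3;
  try (apply: ord3P); rewrite ?mxE ?o3E/=; rewrite ?mxE ?o3E; rewrite /GRing.scale/=; ring.
Qed.

Lemma jordan_diag X Y i : let M := hmx_jordan (hmx X) (hmx Y) in
  M i i = (M i i).1.1.1 *: (cone : C).
Proof.
move=> M; suff [c ->] : exists c, M i i = c *: cone.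
  by rewrite /= /GRing.scale /= addr0 mulr1.
exists (2%:R^-1 * \sum_k cpolar (hmx X i k) (hmx Y i k)).
rewrite /M /hmx_jordan /hmx_mul -big_split -scalerA; congr (_ *: _).
rewrite scaler_suml; apply: eq_bigr => k _.
by rewrite (hmxC X i k) (hmxC Y i k) /= cmul_conj.
Qed.

Lemma hmx_albert_mul X Y i j :
  hmx (albert_mul X Y) i j = hmx_jordan (hmx X) (hmx Y) i j :> C.
Proof.
have low k l : k = l + 1 -> hmx (albert_mul X Y) k l = hmx_jordan (hmx X) (hmx Y) k l.
  by move->; elim/ord3P: l; rewrite /hmx !o3E /= ffunE !o3E.
have [->|nij] := eqVneq i j.
  by rewrite jordan_diag {1}/hmx eqxx /= mxE.
have [|ne] := eqVneq i (j + 1); first exact: low.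
by rewrite hmxC jordanC low //; move: nij ne; elim/ord3P: i; elim/ord3P: j; rewrite ?o3E.
Qed.


Lemma ctauD p q : ctau (p + q) = ctau p + ctau q :> C.
Proof.
case: p q => [[[a b] x] y] [[[a' b'] x'] y'].
by congr (_, _, _, _); apply/rowP => i; rewrite !mxE.
Qed.
Lemma ctauZ k p : ctau (k *: p) = k *: ctau p :> C.
Proof.
case: p => [[[a b] x] y].
by congr (_, _, _, _); apply/rowP => i; rewrite !mxE.
Qed.

Lemma iter_ctau_linear n : linear (iter n (@ctau F)).
Proof.
by move=> k p q; elim: n => //= n ->; rewrite ctauD ctauZ.
Qed.

HB.instance Definition _ n :=
  GRing.isLinear.Build F C C _ (iter n (@ctau F)) (iter_ctau_linear n).

Lemma ctau0 : ctau 0 = 0 :> C.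
Proof. exact: (linear0 (iter 1 (@ctau F))). Qed.

Lemma ctau_cancel (i : 'I_3) p : iter (3 - i) (@ctau F) (iter i (@ctau F) p) = p.
Proof.
rewrite -iterD subnK; first exact: ctau3.
exact/ltnW/ltn_ord.
Qed.

Lemma albert_ext_linear phi : linear (@albert_ext_fun F phi).
Proof.
move=> k X Y; congr (_, _); apply/ffunP => i.
by rewrite !ffunE !linearP.
Qed.
HB.instance Definition _ phi :=
  GRing.isLinear.Build F (albert F) (albert F) _ (albert_ext_fun phi) (albert_ext_linear phi).

Lemma albert_shift_linear : linear (@albert_shift_fun F).
Proof.
move=> k X Y; congr (_, _); first by apply/rowP=> i; rewrite !mxE.
by apply/ffunP => i; rewrite !ffunE ctauD ctauZ.
Qed.
HB.instance Definition _ :=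
  GRing.isLinear.Build F (albert F) (albert F) _ (@albert_shift_fun F) albert_shift_linear.

Lemma albert_extE phi i : albert_ext phi (aE F i) = aE F i.
Proof.
rewrite lfunE; congr (_, _); apply/ffunP => j.
by rewrite !ffunE !linear0.
Qed.

Lemma albert_ext_iotat (phi : 'End(C)) i (x : C) :
  albert_ext phi (aiotat i x) = aiotat i (phi x).
Proof.
rewrite lfunE; congr (_, _); apply/ffunP => j; rewrite !ffunE.
by case: eqP => [->|_]; [rewrite !linearZ /= ctau_cancel | rewrite !linear0].
Qed.

Lemma albert_shiftE i : albert_shift F (aE F i) = aE F (i + 1).
Proof.
rewrite lfunE; congr (_, _).
  by apply/rowP => j; rewrite !mxE subr_eq.
by apply/ffunP => j; rewrite !ffunE ctau0.
Qed.

Lemma albert_shift_iotat i (x : C) :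
  albert_shift F (aiotat i x) = aiotat (i + 1) x.
Proof.
rewrite lfunE; congr (_, _).
  by apply/rowP => j; rewrite !mxE.
apply/ffunP => j; rewrite !ffunE subr_eq.
case: eqP => [_|_]; rewrite ?ctau0 // ctauZ; congr (_ *: _).
by elim/ord3P: i => //=; rewrite ctau3.
Qed.

Lemma okubo_table i : [/\ okubo ce1 ce1 = ce2 :> C, okubo (cu i) (cu i) = cv i :> C,
  okubo (cu i) ce1 = - cu (i + 1) :> C & okubo (cv i) ce2 = - cv (i + 1) :> C].
Proof.
rewrite /okubo !cconjE; elim/ord3P: i; split;
apply: cayleyP => /=; rewrite ?/dot ?/cross ?sum3;
  try (apply: ord3P); rewrite ?mxE ?o3E /= ?mxE ?o3E /=; rewrite /GRing.scale/=; ring.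
Qed.

Lemma cayley_sum (p : C) : p = p.1.1.1 *: ce1 + p.1.1.2 *: ce2 +
  \sum_i p.1.2 0 i *: cu i + \sum_i p.2 0 i *: cv i.
Proof.
rewrite !sum3; case: p => [[[a b] x] y] /=.
apply: cayleyP=> /=; try (apply: ord3P); rewrite ?mxE ?o3E /= ?mxE ?o3E /=; rewrite /GRing.scale/=; ring.
Qed.

Lemma okubo_aut_eq (phi psi : 'End(C)) :
  alg_aut (@okubo F) phi -> alg_aut (@okubo F) psi ->
  phi ce1 = psi ce1 -> phi (cu 1) = psi (cu 1) -> phi = psi.
Proof.
move=> [_ phiM] [_ psiM] eq_e1 eq_u1.
have eq_e2 : phi ce2 = psi ce2.
  by have [<- _ _ _] := okubo_table 1; rewrite phiM psiM eq_e1.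
have eqN a b : okubo a b = - - okubo a b :> C by rewrite opprK.
have eq_u i : phi (cu i) = psi (cu i) -> phi (cu (i + 1)) = psi (cu (i + 1)).
  have [_ _ e _] := okubo_table i.
  by move=> h; rewrite -[cu (i + 1)]opprK -e !linearN /= phiM psiM h eq_e1.
have eq_v i : phi (cv i) = psi (cv i) -> phi (cv (i + 1)) = psi (cv (i + 1)).
  have [_ _ _ e] := okubo_table i.
  by move=> h; rewrite -[cv (i + 1)]opprK -e !linearN /= phiM psiM h eq_e2.
have eq_v1 : phi (cv 1) = psi (cv 1).
  by have [_ <- _ _] := okubo_table 1; rewrite phiM psiM eq_u1.
have eq_u2 := eq_u _ eq_u1; have eq_u0 := eq_u _ eq_u2.
have eq_v2 := eq_v _ eq_v1; have eq_v0 := eq_v _ eq_v2.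
rewrite !o11 ?o21 in eq_u2 eq_u0 eq_v2 eq_v0.
apply/lfunP => p; rewrite (cayley_sum p) !sum3 !linearD !linearZ /=.
by rewrite eq_e1 eq_e2 eq_u1 eq_u2 eq_u0 eq_v1 eq_v2 eq_v0.
Qed.

Definition phi1_fun (w : F) (p : C) : C :=
  let: (a, b, x, y) := p in
  (w * a, w ^+ 2 * b, \row_(i < 3) (w ^+ (i + 2) * x 0 i), \row_(i < 3) (w ^+ (4 - i) * y 0 i)).
Definition phi2_fun (w : F) (p : C) : C :=
  let: (a, b, x, y) := p in (a, b, w *: x, w ^+ 2 *: y).

Lemma phi1_linear w : linear (phi1_fun w).
Proof.
move=> k [[[a b] x] y] [[[a' b'] x'] y'].
apply: cayleyP => /=; try (move=> i; rewrite !mxE); rewrite /GRing.scale /=; ring.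
Qed.
Lemma phi2_linear w : linear (phi2_fun w).
Proof.
move=> k [[[a b] x] y] [[[a' b'] x'] y'].
apply: cayleyP => /=; try (move=> i; rewrite !mxE); rewrite /GRing.scale /=; ring.
Qed.
HB.instance Definition _ w :=
  GRing.isLinear.Build F C C _ (phi1_fun w) (phi1_linear w).
HB.instance Definition _ w :=
  GRing.isLinear.Build F C C _ (phi2_fun w) (phi2_linear w).

Lemma phi1P (w : F) : w ^+ 3 = 1 -> is_okubo_phi1 w (linfun (phi1_fun w)).
Proof.
move=> w3.
split; first split.
- apply/eqP/lker0P => p q; rewrite !lfunE => e.
  have K r : phi1_fun w (phi1_fun w (phi1_fun w r)) = r.
    case: r => [[[a b] x] y]; apply: cayleyP => /=;
    try (apply: ord3P); rewrite ?mxE /=; rewrite /subn /=; ring: w3.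
  by rewrite -(K p) e K.
- move=> p q; rewrite [LHS]lfunE (lfunE _ p) (lfunE _ q) /okubo !cconjE.
  case: p q => [[[a b] x] y] [[[a' b'] x'] y'].
  apply: cayleyP => /=; rewrite /dot /cross ?sum3; try apply: ord3P; rewrite ?mxE ?o3E /=; rewrite ?add0n ?(erefl : (1 %% 3 + 2 = 3)%N) ?(erefl : ((1 %% 3 + 1 %% 3) %% 3 + 2 = 4)%N) ?(erefl: (4-0 = 4)%N) ?(erefl: (4 - 1%%3 = 3)%N)?(erefl: (4 - (1%%3+1%%3)%%3 = 2)%N); ring: w3.
- rewrite lfunE; apply: cayleyP => /=; try (apply: ord3P); rewrite ?mxE ?o3E /=; rewrite /GRing.scale /=; ring: w3.
- rewrite lfunE; apply: cayleyP => /=; try (apply: ord3P); rewrite ?mxE ?o3E /=; rewrite ?w3; ring: w3.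
Qed.

Lemma phi2P (w : F) : w ^+ 3 = 1 -> is_okubo_phi2 w (linfun (phi2_fun w)).
Proof.
move=> w3.
split; first split.
- apply/eqP/lker0P => p q; rewrite !lfunE => e.
  have K r : phi2_fun w (phi2_fun w (phi2_fun w r)) = r.
    case: r => [[[a b] x] y]; apply: cayleyP => //=;
    try (apply: ord3P); rewrite ?mxE /=; ring: w3.
  by rewrite -(K p) e K.
- move=> p q; rewrite [LHS]lfunE (lfunE _ p) (lfunE _ q) /okubo !cconjE.
  case: p q => [[[a b] x] y] [[[a' b'] x'] y'].
  apply: cayleyP => /=; rewrite /dot /cross ?sum3; try apply: ord3P; rewrite ?mxE ?o3E /=; ring: w3.
- by rewrite lfunE; apply: cayleyP => /= [||i|i]; rewrite ?mxE ?scaler0 ?mulr0.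
- by rewrite lfunE; apply: cayleyP => /= [||i|i]; rewrite ?mxE ?scaler0 ?mulr0.
Qed.

Lemma okubo_phi1_unique (w : F) :
  w ^+ 3 = 1 -> exists! phi, is_okubo_phi1 w phi.
Proof.
move=> w3; have [aut1 e1 u1] := phi1P w3; exists (linfun (phi1_fun w)).
split; first by split.
by move=> phi [autp ep up]; apply: okubo_aut_eq; rewrite ?e1 ?ep ?u1 ?up.
Qed.

Lemma okubo_phi2_unique (w : F) :
  w ^+ 3 = 1 -> exists! phi, is_okubo_phi2 w phi.
Proof.
move=> w3; have [aut2 e2 u2] := phi2P w3; exists (linfun (phi2_fun w)).
split; first by split.
by move=> phi [autp ep up]; apply: okubo_aut_eq; rewrite ?e2 ?ep ?u2 ?up.
Qed.

End Checks.

(* Main.v *)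
Require Import Defs.
From HB Require Import structures.
From mathcomp Require Import all_boot all_order all_algebra all_fingroup all_solvable.
From mathcomp Require Import boolp ring.

Set Implicit Arguments.
Unset Strict Implicit.
Unset Printing Implicit Defensive.

Import GRing.Theory.
Local Open Scope ring_scope.

(** Why the Weyl group is SL_3(3).

    Let [x_a], [a] in Z_3^2, be the element of the standard basis of the Okubo
    algebra that has degree [a] for phi_1 and phi_2 (and [x_0 = 0]).  For
    [g = (a, k)] let [X_g] be the sum over [l] of [w ^ (- k l)] times the copy
    of [x_a] in the l-th slot of the Albert algebra; for [a = 0] the slots are
    the diagonal idempotents.  The 27 vectors [X_g] ([abasis]) span the
    components of the grading ([albert_grading_line]) and turn the Albert
    algebra into a twisted group algebra of Z_3^3 ([abasis_mul]):

      [X_g X_h = w ^ psi (g, h) t (g, h) X_(g + h)],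
      [psi (g, h) = (g_1 h_2 - g_2 h_1) (g_3 - h_3)],

    where [t] is 1 if [g] and [h] are proportional, and -1/2 otherwise.

    An automorphism that permutes the components is therefore monomial,
    [X_g |-> lam_g X_(u g)], and the products force [u] to be additive, that is
    [u g = g M] with [M] in GL_3(3).  The question is which [M] admit scalars.

    Necessity of [det M = 1].  The exponent of the defect of associativity of
    three independent degrees is their determinant ([psi_assoc_defect],
    [astruct_assoc]): [(X_g X_h) X_k = w ^ det (g, h, k) X_g (X_h X_k)].  A
    monomial automorphism preserves this defect ([monomial_det]).

    Sufficiency.  Up to sign the coboundary of [psi] is the determinant, so
    [psi o M - psi] is a 2-cocycle when [det M = 1]; it is symmetric and vanishes
    on cyclic subgroups, so the extension of Z_3^3 by Z_3 that it defines is elementary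
    abelian and splits.  Hence [psi o M - psi] is the coboundary of some [f]
    ([twist_coboundary]), and [X_g |-> w ^ (f g) X_(g M)] is an automorphism
    ([monomial_lift]).

    So the Weyl group is SL_3(3) inside Aut(Z_3^3) = GL_3(3).  Over a finite
    field of characteristic different from 2, SL_n is the derived subgroup of
    GL_n ([SL_der1]): it is generated by transvections, and a transvection is
    the commutator of a reflection and another transvection. *)

Local Notation G := 'rV['Z_3]_3.

(** * Transvections and the derived subgroup of GL_n *)

Local Notation mx01 := (mul1mx, mulmx1, mul0mx, mulmx0, addr0, add0r).

Section TransvectionProducts.
Variable F : fieldType.

(** A transvection is [1 + c r] with [r c = 0]; the column [c] and the row [r] are
    arbitrary, so that no choice of basis is involved. *)
Inductive transv_prod n : 'M[F]_n -> Prop :=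
| TransvId : transv_prod 1%:M
| TransvMul (c : 'cV_n) (r : 'rV_n) B :
    r *m c = 0 -> transv_prod B -> transv_prod ((1%:M + c *m r) *m B).

Lemma transv_prodM n (A B : 'M[F]_n) :
  transv_prod A -> transv_prod B -> transv_prod (A *m B).
Proof.
move=> tA tB; elim: tA => [|c r A' rc _ IH]; first by rewrite mul1mx.
by rewrite -mulmxA; apply: TransvMul.
Qed.

Lemma transvP n (c : 'cV[F]_n) (r : 'rV_n) : r *m c = 0 -> transv_prod (1%:M + c *m r).
Proof.
move=> rc; rewrite -[X in transv_prod X]mulmx1.
by apply: TransvMul => //; constructor.
Qed.

(** The inverse of [1 + c r] is [1 - c r]. *)
Lemma transv_prod_cancel n (c : 'cV[F]_n) (r : 'rV_n) A : r *m c = 0 ->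
  transv_prod ((1%:M + c *m r) *m A) -> transv_prod A.
Proof.
move=> rc tA; have -> : A = (1%:M + (- c) *m r) *m ((1%:M + c *m r) *m A).
  suff TK : (1%:M + (- c) *m r) *m (1%:M + c *m r) = 1%:M by rewrite mulmxA TK mul1mx.
  rewrite mulmxDl mul1mx !mulNmx mulmxDr mulmx1 -mulmxA (mulmxA r) rc mul0mx mulmx0 addr0.
  by rewrite addrK.
by apply: TransvMul => //; rewrite mulmxN rc oppr0.
Qed.

Lemma transv_prod_block n (B : 'M[F]_n) : transv_prod B ->
  transv_prod (block_mx 1%:M 0 0 B : 'M_(1 + n)).
Proof.
elim=> [|c r B' rc _ IH]; first by rewrite -scalar_mx_block; constructor.
have -> : block_mx 1%:M 0 0 ((1%:M + c *m r) *m B') =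
    (1%:M + col_mx 0 c *m row_mx 0 r) *m block_mx 1%:M 0 0 B' :> 'M_(1 + n).
  rewrite mul_col_row !mul0mx !mulmx0 scalar_mx_block add_block_mx !addr0.
  by rewrite mulmx_block !mul0mx !mulmx0 !addr0 !add0r mul1mx.
by apply: TransvMul => //; rewrite mul_row_col mul0mx add0r.
Qed.

(** Once the corner is 1, clearing its column and its row takes one transvection
    each, because [col_mx 0 c *m row_mx 1 0] has square zero. *)
Lemma det1_block_transv n (b : 'rV[F]_n) (c : 'cV_n) (d : 'M_n) :
  (forall D : 'M[F]_n, \det D = 1 -> transv_prod D) ->
  \det (block_mx 1%:M b c d : 'M_(1 + n)) = 1 ->
  transv_prod (block_mx 1%:M b c d : 'M_(1 + n)).
Proof.
move=> IH; have -> : block_mx 1%:M b c d = (1%:M + col_mx 0 c *m row_mx 1%:M 0) *m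
    (block_mx 1%:M 0 0 (d - c *m b) *m
     (1%:M + col_mx 1%:M 0 *m row_mx 0 b)) :> 'M_(1 + n).
  rewrite !mul_col_row !mx01 scalar_mx_block !add_block_mx !mx01 !mulmx_block !mx01.
  by rewrite addrC subrK.
rewrite !det_mulmx => detA; apply: TransvMul.
  by rewrite mul_row_col mulmx0 mul0mx addr0.
apply: transv_prodM; last by apply: transvP; rewrite mul_row_col mulmx0 mul0mx addr0.
apply/transv_prod_block/IH; move: detA.
rewrite !mul_col_row !mx01 scalar_mx_block !add_block_mx !mx01.
by rewrite det_lblock !det_ublock !det1 !mul1r mulr1.
Qed.

(** Two factorizations of the block matrix [[1, -r], [c, 1]]. *)
Lemma det_rank1 n (c : 'cV[F]_n) (r : 'rV_n) :
  \det (1%:M + c *m r) = \det (1%:M + r *m c).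
Proof.
transitivity (\det (block_mx 1%:M (- r) c 1%:M : 'M_(1 + n))).
  have -> : block_mx 1%:M (- r) c 1%:M =
      block_mx 1%:M 0 c 1%:M *m block_mx 1%:M (- r) 0 (1%:M + c *m r) :> 'M_(1 + n).
    rewrite mulmx_block !mx01 mulmxN.
    by rewrite addrC addrK.
  by rewrite det_mulmx det_lblock det_ublock !det1 !mul1r.
have -> : block_mx 1%:M (- r) c 1%:M =
    block_mx 1%:M (- r) 0 1%:M *m block_mx (1%:M + r *m c) 0 c 1%:M :> 'M_(1 + n).
  rewrite mulmx_block !mx01 mulNmx.
  by rewrite addrK.
by rewrite det_mulmx det_lblock det_ublock !det1 !mul1r mulr1.
Qed.

Lemma row_dual n (x : 'cV[F]_n) : x != 0 -> exists r : 'rV_n, r *m x = 1%:M.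
Proof.
case/cV0Pn => i xi; exists ((x i 0)^-1 *: delta_mx 0 i).
by apply/matrixP => j k; rewrite -scalemxAl -rowE !ord1 !mxE mulVf.
Qed.

(** Gaussian elimination: if the first column has a nonzero entry below the corner,
    one transvection makes the corner 1; otherwise a transvection first creates
    such an entry. *)
Lemma det1_transv_prod n (A : 'M[F]_n) : \det A = 1 -> transv_prod A.
Proof.
elim: n A => [|n IH] A.
  by rewrite [A]flatmx0 -[X in transv_prod X](flatmx0 1%:M); constructor.
have detT (c : 'cV[F]_n.+1) (r : 'rV_n.+1) : r *m c = 0 -> \det (1%:M + c *m r) = 1.
  by move=> rc; rewrite det_rank1 rc addr0 det1.
move: (A : 'M_(1 + n)); rewrite -[n.+1]/(1 + n)%N => {}A.
rewrite -[A]submxK; move: (ulsubmx A) (ursubmx A) (dlsubmx A) (drsubmx A) => a b c d {A}.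
have step a' b' c' d' : c' != 0 -> \det (block_mx a' b' c' d' : 'M_(1 + n)) = 1 ->
    transv_prod (block_mx a' b' c' d' : 'M_(1 + n)).
  move=> /row_dual[r rc] detA.
  have rc0 : row_mx 0 r *m col_mx (1%:M - a') 0 = 0 :> 'M[F]_1.
    by rewrite mul_row_col mul0mx mulmx0 addr0.
  apply: (transv_prod_cancel rc0).
  have: \det ((1%:M + col_mx (1%:M - a') 0 *m row_mx 0 r) *m block_mx a' b' c' d') = 1.
    by rewrite det_mulmx (detT _ _ rc0) mul1r.
  rewrite mulmxDl mul1mx -mulmxA mul_row_block !mx01 rc mul_col_row !mx01.
  by rewrite add_block_mx !mx01 addrC subrK; apply: det1_block_transv.
have [->|c0] := eqVneq c 0; last exact: step.
rewrite det_ublock det_mx11 => detA; have [n0|n_gt0] := posnP n.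
  have -> : a = 1%:M.
    rewrite [a]mx11_scalar; move: detA; subst n.
    by rewrite det_mx00 mulr1 => ->.
  apply: det1_block_transv => //; rewrite det_ublock det1 mul1r.
  by subst n; apply: det_mx00.
(* Any nonzero column would do. *)
pose v : 'cV[F]_n := const_mx 1.
have vc : row_mx 1%:M 0 *m col_mx 0 v = 0 :> 'M[F]_1 by rewrite mul_row_col !mx01.
apply: (transv_prod_cancel vc).
have: \det ((1%:M + col_mx 0 v *m row_mx 1%:M 0) *m (block_mx a b 0 d : 'M_(1 + n))) = 1.
  by rewrite det_mulmx (detT _ _ vc) mul1r det_ublock det_mx11.
rewrite mulmxDl mul1mx -mulmxA mul_row_block !mx01 mul_col_row !mx01 add_block_mx !mx01.
apply: step; apply/eqP => /matrixP/(_ (Ordinal n_gt0) 0).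
rewrite !mxE big_ord1 !mxE mul1r => a0.
by move: detA; rewrite a0 mul0r => /eqP; rewrite eq_sym oner_eq0.
Qed.

End TransvectionProducts.

Section DerivedGL.
Variables (F : finFieldType) (n : nat).
Hypothesis two_neq0 : 2%:R != 0 :> F.
Local Notation GL := {'GL_n.+1[F]}.

Definition SL_set : {set GL} := [set g | \det (GLval g) == 1].

Lemma GL_of_det (A : 'M[F]_n.+1) : \det A != 0 -> exists g : GL, GLval g = A.
Proof.
move=> dA; have AU : A \is a GRing.unit.
  by rewrite -[_ \is a _]/(A \in unitmx) unitmxE unitfE.
by exists (FinRing.unit _ AU).
Qed.

(** The reflection [R = 1 - 2 c s], with [s c = 1], negates [c] and fixes [r], hence
    inverts [T a = 1 + a c r] under conjugation.  So the commutator of [R] and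
    [T (1/2)] is [T 1]. *)
Lemma transv_der1 (c : 'cV[F]_n.+1) (r : 'rV_n.+1) : r *m c = 0 ->
  exists2 g, g \in [set: GL]^`(1)%g & GLval g = 1%:M + c *m r.
Proof.
move=> rc; have [-> | /row_dual[s sc]] := eqVneq c 0.
  by exists 1%g; rewrite ?group1 // mul0mx addr0.
pose R := 1%:M - 2%:R *: (c *m s); pose T a := 1%:M + a *: (c *m r).
have Rc : R *m c = - c.
  rewrite mulmxBl mul1mx -scalemxAl -mulmxA sc mulmx1 scaler_nat mulr2n.
  by rewrite opprD addrA subrr add0r.
have rR : r *m R = r.
  by rewrite mulmxBr mulmx1 -scalemxAr mulmxA rc mul0mx scaler0 subr0.
have RR : R *m R = 1%:M.
  by rewrite {2}/R mulmxBr mulmx1 -scalemxAr mulmxA Rc mulNmx scalerN opprK subrK.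
move: R Rc rR RR => R Rc rR RR.
have TD a b : T a *m T b = T (a + b).
  rewrite mulmxDr mulmx1 mulmxDl mul1mx -!scalemxAr -!scalemxAl -mulmxA.
  by rewrite (mulmxA r) rc mul0mx mulmx0 !scaler0 addr0 -addrA -scalerDl.
have RTR a : R *m T a *m R = T (- a).
  rewrite /T mulmxDr mulmx1 mulmxDl RR -scalemxAr -scalemxAl.
  rewrite -mulmxA -(mulmxA c) rR mulmxA Rc.
  by rewrite mulNmx scalerN scaleNr.
have detT a : \det (T a) = 1.
  by rewrite /T scalemxAl det_rank1 -scalemxAr rc scaler0 addr0 det1.
have detR : \det R != 0.
  apply/eqP => R0; have := det1 F n.+1; rewrite -RR det_mulmx R0 mul0r => /eqP.
  by rewrite eq_sym oner_eq0.
have [x xE] := GL_of_det detR.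
have [y yE] : exists y : GL, GLval y = T 2%:R^-1.
  by apply: GL_of_det; rewrite detT oner_eq0.
pose gT : finGroupType := GL.
exists [~ x : gT, y : gT]%g.
  rewrite derg1.
  exact: (@mem_commg gT setT setT x y (in_setT _) (in_setT _)).
have xV : GLval x^-1%g = R.
  have RU : R \in unitmx by rewrite unitmxE unitfE.
  by rewrite GL_VxE xE -[LHS]mulmx1 -RR mulmxA mulVmx // mul1mx.
have yV : GLval y^-1%g = T (- 2%:R^-1).
  have TU : T 2%:R^-1 \in unitmx by rewrite unitmxE detT unitr1.
  have TT : T 2%:R^-1 *m T (- 2%:R^-1) = 1%:M by rewrite TD addrN /T scale0r addr0.
  by rewrite GL_VxE yE -[LHS]mulmx1 -TT mulmxA mulVmx // mul1mx.
rewrite commgEl /conjg !GL_MxE xV yV xE yE !mulmxA RTR opprK TD.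
have -> : 2%:R^-1 + 2%:R^-1 = 1 :> F by rewrite -[X in X + X]mul1r -mulrDl divff.
by rewrite /T scale1r.
Qed.

Lemma SL_der1 : SL_set = [set: GL]^`(1)%g.
Proof.
apply/eqP; rewrite eqEsubset; apply/andP; split; last first.
  have gSL : group_set SL_set.
    apply/group_setP; split=> [|x y]; first by rewrite inE GL_1E det1.
    by rewrite !inE GL_MxE det_mulmx => /eqP-> /eqP->; rewrite mulr1.
  rewrite derg1 (gen_subG _ (Group gSL)); apply/subsetP => _ /imset2P[x y _ _ ->].
  rewrite inE commgEl /conjg !GL_MxE !GL_VxE !det_mulmx !det_inv.
  rewrite mulrCA mulKf ?GL_det // mulVf ?GL_det //.
suff gen A : transv_prod A -> exists2 g, g \in [set: GL]^`(1)%g & GLval g = A.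
  apply/subsetP => g; rewrite inE => /eqP/det1_transv_prod/gen[h hder hg].
  by rewrite -(val_inj hg).
elim=> [|c r B rc _ [g gder <-]]; first by exists 1%g; rewrite ?group1.
have [h hder hE] := transv_der1 rc.
by exists (h * g)%g; rewrite ?groupM // GL_MxE hE.
Qed.

End DerivedGL.

(** * The general linear group as automorphism group of Z_3^3 *)

Section GLPerm.
Local Notation GL := {'GL_3['F_3]}.

(** 'F_3 is 'Z_3 only up to conversion; this cast fixes the presentation that the
    degrees use. *)
Definition mx_of_GL (M : GL) : 'M['Z_3]_3 := GLval M.

Lemma mx_of_GL_inj (M : GL) : injective (fun g : G => g *m mx_of_GL M).
Proof.
apply: (can_inj (g := fun g => g *m mx_of_GL M^-1%g)) => g.
have e : (GLval M *m GLval M^-1%g = 1%:M :> 'M['F_3]_3) := mulmxV (GL_unitmx M).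
by rewrite -mulmxA [X in _ *m X]e mulmx1.
Qed.

Definition gperm (M : GL) : {perm G} := perm (@mx_of_GL_inj M).

Lemma gpermE M g : gperm M g = g *m mx_of_GL M.
Proof. exact: permE. Qed.

Lemma gpermM : {in [set: GL] &, {morph gperm : M N / (M * N)%g}}.
Proof.
by move=> M N _ _; apply/permP => g; rewrite permM !gpermE -mulmxA.
Qed.
Canonical gperm_morphism := Morphism gpermM.

Lemma gperm_inj : ('injm gperm)%g.
Proof.
apply/injmP => M N _ _ e; apply: val_inj; apply/row_matrixP => i.
rewrite !rowE; have := congr1 (fun u : {perm G} => u (delta_mx 0 i)) e.
by rewrite /= !gpermE.
Qed.

Lemma additive_mx (u : G -> G) : {morph u : x y / x + y} ->
  exists M : 'M['Z_3]_3, forall g, u g = g *m M.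
Proof.
move=> uD; have u0 : u 0 = 0 by apply: (addrI (u 0)); rewrite -uD !addr0.
have uZ (k : 'Z_3) g : u (k *: g) = k *: u g.
  elim/ord3P: k; first by rewrite !scale0r.
    by rewrite !scale1r.
  by rewrite !scaler_nat !mulr2n uD.
exists (\matrix_i u (delta_mx 0 i)) => g.
by rewrite [g in LHS]row_sum_delta mulmx_sum_row sum3 !uD !uZ sum3 !rowK.
Qed.

Lemma Aut_G_additive (u : {perm G}) :
  reflect {morph u : x y / x + y} (u \in Aut [set: G]).
Proof.
rewrite inE; apply: (iffP andP) => [[_ /morphicP um] x y | uD].
  by apply: um; rewrite inE.
split; first by apply/subsetP => x; rewrite inE.
by apply/morphicP => x y _ _; apply: uD.
Qed.

Lemma Aut_G : Aut [set: G] = gperm @: [set: GL].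
Proof.
apply/setP => u; apply/Aut_G_additive/imsetP => [uD | [M _ ->] x y]; last first.
  by rewrite !gpermE mulmxDl.
have [M uM] := additive_mx uD.
have MU : (M : 'M['F_3]_3) \is a GRing.unit.
  rewrite -[_ \is a _]/(_ \in unitmx) -row_free_unit; apply: inj_row_free => v vM.
  have v0 : u v = u 0 by rewrite !uM mul0mx; exact: vM.
  exact: perm_inj v0.
exists (FinRing.unit _ MU) => //.
by apply/permP => g; rewrite gpermE uM.
Qed.

End GLPerm.

(** * Coordinates in the Cayley and Okubo algebras *)

Section CayleyOkubo.
Variable F : fieldType.
Local Notation C := (cayley F).

Local Ltac cay :=
  apply: cayleyP => /=; rewrite ?/dot ?/cross ?sum3;
  try (apply: ord3P); rewrite ?mxE ?o3E /= ?mxE ?o3E /=; rewrite /GRing.scale/=; try ring.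

Lemma cmul_linearl (q : C) : linear (fun p : C => cmul p q : C).
Proof.
move=> k; case: q => [[[a b] x] y] [[[a' b'] x'] y'] [[[a'' b''] x''] y'']; cay.
Qed.

Lemma cmul_linearr (p : C) : linear (fun q : C => cmul p q : C).
Proof.
move=> k; case: p => [[[a b] x] y] [[[a' b'] x'] y'] [[[a'' b''] x''] y'']; cay.
Qed.

Lemma ctauM (p q : C) : ctau (cmul p q) = cmul (ctau p) (ctau q).
Proof.
case: p q => [[[a b] x] y] [[[a' b'] x'] y']; cay.
Qed.

Lemma ctau_conj (p : C) : ctau (cconj p) = cconj (ctau p).
Proof. rewrite !cconjE; case: p => [[[a b] x] y]; cay. Qed.

Lemma cpolar_tau (p q : C) : cpolar (ctau p) (ctau q) = cpolar p q.
Proof.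
rewrite !cpolarE; case: p q => [[[a b] x] y] [[[a' b'] x'] y'].
by rewrite /= /dot !sum3 !mxE !o3E; ring.
Qed.

(** The element of degree [(i, j)] for phi_1 and phi_2: [e_1], [e_2] have degrees
    (1, 0), (2, 0), and [u_1], [v_1] have degrees (0, 1), (0, 2); the other [u_i]
    and [v_i] follow from [u_(i+1) = - u_i * e_1] and [v_(i+1) = - v_i * e_2].
    Nothing has degree (0, 0), whence the value 0. *)
Definition okb (i j : 'I_3) : C :=
  if j == 0 then if i == 1 then ce1 else if i == 2%:R then ce2 else 0
  else if j == 1 then cu (i + 1) else cv (1 - i).

Definition okb_coord (i j : 'I_3) (p : C) : F :=
  if j == 0 then if i == 1 then p.1.1.1 else if i == 2%:R then p.1.1.2 else 0
  else if j == 1 then p.1.2 0 (i + 1) else p.2 0 (1 - i).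

Definition okb_sign (i j k l : 'I_3) : F :=
  if (i == k) && (j == l) then 1 else if i * l - j * k == 2%:R then -1 else 0.

(** In this form the 81 products of basis elements can be read off. *)
Lemma okuboE (p q : C) : okubo p q =
  (p.1.1.2 * q.1.1.2 - \sum_i p.1.2 0 (i - 1) * q.2 0 (i + 1),
   p.1.1.1 * q.1.1.1 - \sum_i p.2 0 (i - 1) * q.1.2 0 (i + 1),
   \row_i (p.2 0 i * q.2 0 i - p.2 0 (i + 1) * q.2 0 (i - 1)
     - p.1.1.2 * q.1.2 0 (i + 1) - q.1.1.1 * p.1.2 0 (i - 1)),
   \row_i (p.1.2 0 i * q.1.2 0 i - p.1.2 0 (i + 1) * q.1.2 0 (i - 1)
     - p.1.1.1 * q.2 0 (i + 1) - q.1.1.2 * p.2 0 (i - 1))).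
Proof.
rewrite /okubo !cconjE; case: p q => [[[a b] x] y] [[[a' b'] x'] y'].
cay.
Qed.

(** In the Okubo algebra one of the two products of independent homogeneous
    elements vanishes; the sign of the determinant of the degrees tells which. *)
Lemma okb_mul i j k l :
  okubo (okb i j) (okb k l) = okb_sign i j k l *: okb (i + k) (j + l).
Proof.
rewrite okuboE.
elim/ord3P: j; elim/ord3P: l; elim/ord3P: i; elim/ord3P: k;
  rewrite /okb /okb_sign ?o3E /=; apply: cayleyP; rewrite /= ?sum3;
  try apply: ord3P; rewrite /= ?mxE ?o3E /=; rewrite /GRing.scale/=; ring.
Qed.

End CayleyOkubo.

(** * The product of the Albert algebra *)

(** 3 diagonal entries and 3 octonions of dimension 1 + 1 + 3 + 3. *)
Lemma dim_albert (F : fieldType) : \dim {:albert F} = 27%N.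
Proof.
rewrite dimvf.
change (3 + #|'I_3| * (1 + 1 + 3 + 3) = 27)%N.
by rewrite card_ord.
Qed.

Lemma scale_of_linear (R : pzRingType) (U V : lmodType R) (f : U -> V) :
  linear f -> forall k x, f (k *: x) = k *: f x.
Proof.
move=> lin_f; pose fM := GRing.isLinear.Build _ _ _ _ f lin_f.
pose fL : {linear U -> V} := HB.pack f fM.
exact: (linearZZ fL).
Qed.

Lemma sum_of_linear (R : pzRingType) (U V : lmodType R) (f : U -> V) :
  linear f -> forall (I : finType) (E : I -> U), f (\sum_i E i) = \sum_i f (E i).
Proof.
move=> lin_f; pose fM := GRing.isLinear.Build _ _ _ _ f lin_f.
pose fL : {linear U -> V} := HB.pack f fM.
by move=> I E; exact: (linear_sum fL).
Qed.

Section AlbertProduct.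
Variable F : fieldType.
Hypothesis two_neq0 : 2%:R != 0 :> F.
Local Notation C := (cayley F).
Local Notation half := (2%:R^-1 : F).

Local Ltac cay :=
  apply: cayleyP => /=; rewrite ?/dot ?/cross ?sum3;
  try (apply: ord3P); rewrite ?mxE ?o3E /= ?mxE ?o3E /=; rewrite /GRing.scale/=; try ring.

(** The classical form of the product: norms on the diagonal, and in the slot [i] the
    Peirce action of the idempotents together with [conj a * conj b] from the two
    other slots. *)
Lemma albert_mulE (X Y : albert F) : albert_mul X Y =
  (\row_i (X.1 0 i * Y.1 0 i +
     half * (cpolar (X.2 (i + 1)) (Y.2 (i + 1))
             + cpolar (X.2 (i + 2%:R)) (Y.2 (i + 2%:R)))),
   [ffun i => half *: ((X.1 0 (i + 1) + X.1 0 (i + 2%:R)) *: Y.2 i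
     + (Y.1 0 (i + 1) + Y.1 0 (i + 2%:R)) *: X.2 i
     + cmul (cconj (X.2 (i + 1))) (cconj (Y.2 (i + 2%:R)))
     + cmul (cconj (Y.2 (i + 1))) (cconj (X.2 (i + 2%:R))))]).
Proof.
rewrite /albert_mul /hmx_coord /hmx_jordan /hmx_mul; congr (_, _).
  apply/rowP => i; rewrite !mxE -big_split /=.
  under eq_bigr => k _ do rewrite (hmxC X i k) (hmxC Y i k) cmul_conj.
  rewrite -scaler_suml sum3 /= /GRing.scale /= addr0 mulr1.
  have polar_conj (p q : C) : cpolar (cconj p) (cconj q) = cpolar p q.
    by rewrite !cpolarE !cconjE /= /dot !sum3 !mxE; ring.
  have polar_one (k l : F) : cpolar (k *: cone) (l *: cone : C) = 2%:R * (k * l).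
    by rewrite cpolarE /= /dot !sum3 !mxE /GRing.scale /=; ring.
  by elim/ord3P: i; rewrite /hmx !o3E !polar_conj polar_one; field.
have onel (k : F) (p : C) : cmul (k *: cone) p = k *: p.
  case: p => [[[? ?] ?] ?]; cay.
have oner (k : F) (p : C) : cmul p (k *: cone) = k *: p.
  case: p => [[[? ?] ?] ?]; cay.
apply/ffunP => i; rewrite !ffunE !sum3; congr (_ *: _).
elim/ord3P: i; rewrite /hmx !o3E; cbv iota; rewrite !onel !oner !scalerDl.
all: set p := cmul _ _; set q := cmul _ _.
- by rewrite [LHS](AC (3*3) (5*3*(2*6)*1*4)).
- by rewrite [LHS](AC (3*3) (6*1*(3*4)*2*5)).
- by rewrite [LHS](AC (3*3) (4*2*(1*5)*3*6)).
Qed.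

Lemma albert_mulC (X Y : albert F) : albert_mul X Y = albert_mul Y X.
Proof.
rewrite !albert_mulE; congr (_, _).
  by apply/rowP => i; rewrite !mxE !cpolarE; ring.
apply/ffunP => i; rewrite !ffunE; congr (_ *: _).
by rewrite [LHS](AC (2*1*1) (2*1*4*3)).
Qed.

Lemma albert_mul_linearl (Y : albert F) : linear (fun X : albert F => albert_mul X Y).
Proof.
move=> k X X'; set Z := k *: X + X'.
have Z1 j : Z.1 0 j = k * X.1 0 j + X'.1 0 j by rewrite !mxE.
have Z2 j : Z.2 j = k *: X.2 j + X'.2 j by rewrite !ffunE.
rewrite !albert_mulE; move: Z Z1 Z2 => Z Z1 Z2; congr (_, _).
  apply/rowP => i; rewrite !mxE !Z1 !Z2 !cpolarE /= /dot !sum3 !mxE.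
  by rewrite /GRing.scale /=; ring.
apply/ffunP => i; rewrite !ffunE !Z1 !Z2 !cconjB !cconjZ.
have mulL p p' q : cmul (k *: p + p') q = k *: cmul p q + cmul p' q :> C.
  exact: cmul_linearl.
have mulR p q q' : cmul p (k *: q + q') = k *: cmul p q + cmul p q' :> C.
  exact: cmul_linearr.
rewrite mulL mulR.
move: (cmul _ _) (cmul _ _) (cmul _ _) (cmul _ _) (X.2 i) (X'.2 i) (Y.2 i).
move=> [[[? ?] ?] ?] [[[? ?] ?] ?] [[[? ?] ?] ?] [[[? ?] ?] ?].
move=> [[[? ?] ?] ?] [[[? ?] ?] ?] [[[? ?] ?] ?].
by apply: cayleyP => /= *; rewrite ?mxE /GRing.scale /=; ring.
Qed.

End AlbertProduct.

(** * A homogeneous basis and its multiplication table *)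

Section HomogeneousBasis.
Variables (F : fieldType) (w : F).
Hypothesis w_prim : 3.-primitive_root w.
Hypothesis two_neq0 : 2%:R != 0 :> F.
Local Notation C := (cayley F).
Local Notation half := (2%:R^-1 : F).

#[local] Arguments cmul : simpl never.
#[local] Arguments cconj : simpl never.
#[local] Arguments ctau : simpl never.
#[local] Arguments cpolar : simpl never.

(** The degrees that occur on the diagonal. *)
Local Notation axial g := ((g 0 0 == 0) && (g 0 1 == 0)).

Definition chi (k : 'Z_3) : F := w ^+ k.

Lemma chi0 : chi 0 = 1. Proof. by []. Qed.

Lemma chiD k l : chi (k + l) = chi k * chi l.
Proof. by rewrite /chi -exprD -(prim_expr_mod w_prim (k + l)). Qed.

Lemma chi_neq0 k : chi k != 0.
Proof.
by rewrite expf_neq0 // (prim_root_eq0 w_prim).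
Qed.

Lemma chi_inj : injective chi.
Proof.
move=> k l /eqP; rewrite (eq_prim_root_expr w_prim) => /eqP e.
by apply: val_inj; move: e; rewrite (modn_small (ltn_ord k)) (modn_small (ltn_ord l)).
Qed.

Lemma w_sqr : w ^+ 2 = - 1 - w.
Proof.
have := prim_expr_order w_prim; have w1 : w - 1 != 0.
  rewrite subr_eq0; apply/eqP => w1; move: (eq_prim_root_expr w_prim 1 0).
  by rewrite w1 !expr1n eqxx.
move=> w3; apply/eqP; rewrite -subr_eq0; apply/eqP/(mulfI w1).
by ring: w3.
Qed.

(** Proportionality over Z_3, whose only scalars are 0, 1 and -1. *)
Definition dependent (g h : G) := [|| g == 0, h == 0, g == h | g == - h].
(** The exponent of [w] in the multiplication table. *)
Definition psi (g h : G) : 'Z_3 :=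
  (g 0 0 * h 0 1 - g 0 1 * h 0 0) * (g 0 2%:R - h 0 2%:R).
Definition astruct (g h : G) : F := chi (psi g h) * (if dependent g h then 1 else - half).

Lemma row3_eqE (g h : G) :
  (g == h) = [&& g 0 0 == h 0 0, g 0 1 == h 0 1 & g 0 2%:R == h 0 2%:R].
Proof.
apply/eqP/and3P => [-> // | [/eqP e0 /eqP e1 /eqP e2]].
by apply/rowP; apply: ord3P.
Qed.

(** [1 + w + w ^ 2 = 0]: the source of the two values 1 and -1/2 in the table. *)
Lemma chi_addN k : half * (chi k + chi (- k)) = if k == 0 then 1 else - half.
Proof.
elim/ord3P: k; rewrite /chi /=; last 2 first.
- by rewrite w_sqr; field.
- by rewrite w_sqr; field.
by rewrite -mulr2n mulVf.
Qed.

Lemma chiM D k :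
  chi (D * k) = if D == 1 then chi k else if D == 2%:R then chi (- k) else 1.
Proof.
elim/ord3P: D => /=; first by rewrite mul0r.
  by rewrite mul1r.
by congr chi; elim/ord3P: k; apply: val_inj.
Qed.

(** Two pairs [a], [b] over Z_3 with [a + b != 0] have determinant 1 or -1, or else
    one of them vanishes, or they are equal. *)
Variant slot_spec : bool -> bool -> bool -> bool -> bool -> Prop :=
| SlotPos : slot_spec true false false false false
| SlotNeg : slot_spec false true false false false
| SlotZeroL : slot_spec false false true false false
| SlotZeroR : slot_spec false false false true false
| SlotEq : slot_spec false false false false true.

Lemma slotP (a0 a1 b0 b1 : 'Z_3) : (a0 + b0 != 0) || (a1 + b1 != 0) ->
  slot_spec (a0 * b1 - a1 * b0 == 1) (a0 * b1 - a1 * b0 == 2%:R)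
    ((a0 == 0) && (a1 == 0)) ((b0 == 0) && (b1 == 0))
    ((a0 == b0) && (a1 == b1)).
Proof.
by move: a0 a1 b0 b1; do 4 apply: ord3P => //; move=> _; constructor.
Qed.

Lemma detC_eq (a0 a1 b0 b1 : 'Z_3) :
  (b0 * a1 - b1 * a0 == 2%:R) = (a0 * b1 - a1 * b0 == 1).
Proof.
have -> : b0 * a1 - b1 * a0 = - (a0 * b1 - a1 * b0) by ring.
by elim/ord3P: (_ - _).
Qed.

(** The coefficient of [X_g X_h] in an off-diagonal slot: the first two terms come
    from the idempotents, the other two from the Okubo products in both orders. *)
Lemma astruct_slot (g h : G) : (g 0 0 + h 0 0 != 0) || (g 0 1 + h 0 1 != 0) ->
  half * ((axial g)%:R * (chi (g 0 2%:R) + chi (- g 0 2%:R)) +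
   (axial h)%:R * (chi (h 0 2%:R) + chi (- h 0 2%:R)) +
   chi (h 0 2%:R - g 0 2%:R) * okb_sign F (g 0 0) (g 0 1) (h 0 0) (h 0 1) +
   chi (g 0 2%:R - h 0 2%:R) * okb_sign F (h 0 0) (h 0 1) (g 0 0) (g 0 1)) = astruct g h.
Proof.
rewrite /astruct /dependent /psi !row3_eqE !mxE /okb_sign chiM.
rewrite ![h 0 _ == g 0 _]eq_sym !andbA.
move: (g 0 0) (g 0 1) (g 0 2%:R) (h 0 0) (h 0 1) (h 0 2%:R) => a0 a1 k b0 b1 l ab.
rewrite (detC_eq a0 a1 b0 b1).
have -> : (a0 == - b0) && (a1 == - b1) = false.
  by apply: contraTF ab => /andP[/eqP-> /eqP->]; rewrite !addNr eqxx.
case: (slotP ab) => /=;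
  rewrite ?mul0r ?mulr0 ?mulr1 ?mul1r ?addr0 ?add0r ?orbF ?chi_addN //.
- by ring.
- by rewrite opprB; ring.
- by rewrite -(opprB k l) addrC chi_addN subr_eq0.
Qed.

(** The coefficient of [X_g X_h] on the diagonal, when the degrees cancel in the
    first two coordinates. *)
Lemma astruct_diag (g h : G) : g 0 0 + h 0 0 = 0 -> g 0 1 + h 0 1 = 0 ->
  (axial g)%:R * (axial h)%:R +
  half * ((chi (g 0 2%:R + h 0 2%:R) + chi (-(g 0 2%:R + h 0 2%:R)))
  * (~~ (axial g))%:R) = astruct g h.
Proof.
rewrite /astruct /dependent /psi !row3_eqE !mxE.
move: (g 0 0) (g 0 1) (g 0 2%:R) (h 0 0) (h 0 1) (h 0 2%:R) => a0 a1 k b0 b1 l.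
move=> /eqP; rewrite addr_eq0 => /eqP-> /eqP; rewrite addr_eq0 => /eqP->.
rewrite !oppr_eq0 !eqxx /= !andbA.
have -> : - b0 * b1 - - b1 * b0 = 0 by ring.
have b2 x : (- x == x :> 'Z_3) = (x == 0) by elim/ord3P: x.
rewrite mul0r chi0 mul1r !b2 mulrA chi_addN addr_eq0.
case: ((b0 == 0) && _) => /=; last by rewrite mulr0 mulr1 add0r.
rewrite mulr0 mulr1 addr0; case: ifP => //.
by move: k l; do 2 apply: ord3P.
Qed.

(** The discrete Fourier transform of the three copies of [okb i j], which makes the
    cyclic shift of the slots diagonal. *)
Definition abasis (g : G) : albert F :=
  (\row_l ((axial g)%:R * chi (- (g 0 2%:R * l))),
   [ffun l : 'I_3 => chi (- (g 0 2%:R * l)) *: iter l (@ctau F) (okb F (g 0 0) (g 0 1))]).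

(** The twist by [ctau] in the l-th slot turns the product between slots into the
    Okubo product. *)
Lemma okubo_tau (l : 'I_3) (p q : C) :
  cmul (cconj (iter (l + 1)%R (@ctau F) p)) (cconj (iter (l + 2%:R)%R (@ctau F) q)) =
  iter l (@ctau F) (okubo p q).
Proof.
by elim/ord3P: l; rewrite ?o3E /okubo /= !ctau_conj ?ctauM ?ctau_conj ?ctau3.
Qed.

Lemma cpolar_iter (n : nat) (p q : C) :
  cpolar (iter n (@ctau F) p) (iter n (@ctau F) q) = cpolar p q.
Proof. by elim: n => //= n IH; rewrite cpolar_tau. Qed.

Lemma cpolarZ (k l : F) (p q : C) : cpolar (k *: p) (l *: q) = k * l * cpolar p q.
Proof. by rewrite !cpolarE /= /dot !sum3 !mxE /GRing.scale /=; ring. Qed.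

Lemma okb_polar i j k l :
  cpolar (okb F i j) (okb F k l) =
    ([&& i + k == 0, j + l == 0 & ~~ ((i == 0) && (j == 0))])%:R.
Proof.
rewrite cpolarE /dot !sum3.
by elim/ord3P: j; elim/ord3P: l; elim/ord3P: i; elim/ord3P: k;
  rewrite /okb ?o3E /= !mxE ?o3E /=; ring.
Qed.

Lemma okb_coord_okb i j k l :
  okb_coord i j (okb F k l) = ([&& i == k, j == l & ~~ ((i == 0) && (j == 0))])%:R.
Proof.
by elim/ord3P: j; elim/ord3P: l; elim/ord3P: i; elim/ord3P: k;
  rewrite /okb /okb_coord ?o3E /= ?mxE ?o3E /=.
Qed.

Lemma chi_shift1 (k l : 'Z_3) : chi (- (k * (l + 1))) = chi (- (k * l)) * chi (- k).
Proof. by rewrite -chiD //; congr chi; ring. Qed.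

Lemma chi_shift2 (k l : 'Z_3) : chi (- (k * (l + 2%:R))) = chi (- (k * l)) * chi k.
Proof.
have -> : 2%:R = -1 :> 'Z_3 by apply: val_inj.
by rewrite -chiD //; congr chi; ring.
Qed.

Lemma chi_mulD (k k' l : 'Z_3) :
  chi (- ((k + k') * l)) = chi (- (k * l)) * chi (- (k' * l)).
Proof. by rewrite -chiD //; congr chi; ring. Qed.

Lemma iter_ctauZ (n : nat) k (p : C) :
  iter n (@ctau F) (k *: p) = k *: iter n (@ctau F) p.
Proof. by rewrite linearZ. Qed.

Lemma abasis_mul g h : albert_mul (abasis g) (abasis h) = astruct g h *: abasis (g + h).
Proof.
rewrite albert_mulE //; congr (_, _).
  apply/rowP => l; rewrite !mxE !ffunE !cpolarZ !cpolar_iter !okb_polar.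
  have [/andP[/eqP e0 /eqP e1]|ne] :=
    boolP ((g 0 0 + h 0 0 == 0) && (g 0 1 + h 0 1 == 0)); last first.
    rewrite mul0r mulr0.
    have -> : [&& g 0 0 + h 0 0 == 0, g 0 1 + h 0 1 == 0 & ~~ (axial g)] = false.
      by rewrite andbA (negPf ne).
    have -> : (axial g)%:R * chi (- (g 0 2%:R * l)) *
      ((axial h)%:R * chi (- (h 0 2%:R * l))) = 0.
      move: ne; case: (g 0 0 =P 0) => [->|_]; rewrite ?mul0r //.
      case: (g 0 1 =P 0) => [->|_]; rewrite ?mul0r // !add0r => /negPf->.
      by rewrite mul0r mulr0.
    by rewrite /= !(mulr0, addr0).
  rewrite -(astruct_diag e0 e1) e0 e1 eqxx /= !chi_shift1 !chi_shift2.
  rewrite chi_mulD opprD !chiD //.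
  by move: (_%:R) (_%:R) (chi (- (_ * _))) (chi (- (_ * _))) => *; ring.
apply/ffunP => l; rewrite !ffunE !mxE !cconjZ.
have mulZ (x y : F) (p q : C) : cmul (x *: p) (y *: q) = x * y *: cmul p q.
  rewrite (scale_of_linear (cmul_linearl _)) (scale_of_linear (cmul_linearr _)).
  by rewrite scalerA.
rewrite !mulZ !okubo_tau !okb_mul !iter_ctauZ !chi_shift1 !chi_shift2.
rewrite [h 0 0 + _]addrC [h 0 1 + _]addrC.
set A := (g 0 0 == 0) && _; set B := (h 0 0 == 0) && _.
set x := iter _ _ (okb F (h 0 0) _); set y := iter _ _ (okb F (g 0 0) _).
set z := iter _ _ (okb F (_ + _) _).
have Ax : A%:R *: x = A%:R *: z.
  rewrite /A; case: (g 0 0 =P 0) => [ea|]; last by rewrite !scale0r.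
  by case: (g 0 1 =P 0) => [eb|]; rewrite ?scale0r // /z ea eb !add0r.
have By : B%:R *: y = B%:R *: z.
  rewrite /B; case: (h 0 0 =P 0) => [ea|]; last by rewrite !scale0r.
  by case: (h 0 1 =P 0) => [eb|]; rewrite ?scale0r // /z ea eb !addr0.
have scaleD (b c1 c2 c3 : F) (p q : C) : b *: p = b *: q ->
    (b * c1 + b * c2) *: (c3 *: p) = ((b * c1 + b * c2) * c3) *: q.
  move=> e; transitivity (((c1 + c2) * c3) *: (b *: p)); last rewrite e.
    by rewrite !scalerA; congr (_ *: _); ring.
  by rewrite scalerA; congr (_ *: _); ring.
rewrite (scaleD _ _ _ _ _ _ Ax) (scaleD _ _ _ _ _ _ By) !scalerA -!scalerDl.
have [ab0|ab] := boolP ((g 0 0 + h 0 0 == 0) && (g 0 1 + h 0 1 == 0)).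
  case/andP: ab0 => /eqP ea /eqP eb.
  suff -> : z = 0 by rewrite !scaler0.
  by rewrite /z ea eb /okb !eqxx linear0.
rewrite scalerA -astruct_slot //; last by rewrite -negb_and.
congr (_ *: _); rewrite chi_mulD -/A -/B.
by rewrite !chiD //; ring.
Qed.

(** * The components of the grading *)

Lemma three_neq0 : 3%:R != 0 :> F.
Proof.
apply/eqP => z; have e : (w - 1) ^+ 2 = 0.
  have -> : (w - 1) ^+ 2 = w ^+ 2 + w + 1 - 3%:R * w by ring.
  by rewrite z w_sqr; ring.
move/eqP: e; rewrite expf_eq0 subr_eq0 /= => /eqP w1.
by move: (eq_prim_root_expr w_prim 1 0); rewrite w1 !expr1n eqxx.
Qed.

(** Orthogonality of the characters of Z_3. *)
Lemma chi_orth (k k' : 'Z_3) :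
  3%:R^-1 * \sum_l chi (k * l) * chi (- (k' * l)) = (k == k')%:R.
Proof.
have -> : (k == k') = (k - k' == 0) by rewrite subr_eq0.
under eq_bigr => l _ do rewrite -chiD // -mulrBl.
elim/ord3P: (k - k'); rewrite sum3 /chi /=.
- by field; exact: three_neq0.
- by rewrite w_sqr //; ring.
- by rewrite w_sqr //; ring.
Qed.

(** The inverse Fourier transform of the coordinates along [okb]. *)
Definition acoord (g : G) (v : albert F) : F :=
  3%:R^-1 * \sum_(l : 'I_3) chi (g 0 2%:R * l) *
    ((axial g)%:R * v.1 0 l
     + okb_coord (g 0 0) (g 0 1) (iter (3 - l) (@ctau F) (v.2 l))).

Lemma okb_coordP i j k (p q : C) :
  okb_coord i j (k *: p + q) = k * okb_coord i j p + okb_coord i j q.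
Proof.
rewrite /okb_coord; case: (j == 0); last first.
  by case: (j == 1); rewrite [LHS]mxE; congr (_ + _); rewrite [LHS]mxE.
case: (i == 1); first exact: erefl.
by case: (i == 2%:R); [exact: erefl | rewrite mulr0 addr0].
Qed.

Lemma okb_coordZ i j k (p : C) : okb_coord i j (k *: p) = k * okb_coord i j p.
Proof.
have okb_coord0 : okb_coord i j (0 : C) = 0.
  have := okb_coordP i j 1 0 0; rewrite scaler0 addr0 mul1r => e.
  by apply: (addrI (okb_coord i j (0 : C))); rewrite addr0 -e.
by rewrite -[k *: p]addr0 okb_coordP okb_coord0 addr0.
Qed.

Lemma acoordP g k v v' : acoord g (k *: v + v') = k * acoord g v + acoord g v'.
Proof.
rewrite /acoord mulrCA -mulrDr; congr (_ * _).
have e1 l : (k *: v + v').1 0 l = k * v.1 0 l + v'.1 0 l by rewrite !mxE.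
have e2 l : (k *: v + v').2 l = k *: v.2 l + v'.2 l by rewrite !ffunE.
move: (k *: v + v') e1 e2 => u e1 e2.
rewrite mulr_sumr -big_split; apply: eq_bigr => l _.
rewrite e1 e2 iter_ctau_linear okb_coordP /=.
by move: (okb_coord _ _ _) (okb_coord _ _ _) => *; ring.
Qed.

Lemma acoord_linear g : linear (acoord g : albert F -> F^o).
Proof. exact: acoordP. Qed.

Lemma acoordZ g k v : acoord g (k *: v) = k * acoord g v.
Proof. exact: (scale_of_linear (acoord_linear g)). Qed.

Lemma acoord_sum g (I : finType) (E : I -> albert F) :
  acoord g (\sum_i E i) = \sum_i acoord g (E i).
Proof. exact: (sum_of_linear (acoord_linear g)). Qed.

Lemma acoord_abasis g h : acoord g (abasis h) = (g == h)%:R.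
Proof.
have factor (a b c d e : F) : a * (b * (c * d) + d * e) = (b * c + e) * (a * d).
  by ring.
rewrite row3_eqE andbA /acoord.
under eq_bigr => l _.
  rewrite [(abasis h).1 _ _]mxE ffunE iter_ctauZ ctau_cancel okb_coordZ okb_coord_okb.
  rewrite factor.
over.
rewrite -mulr_sumr mulrCA chi_orth.
rewrite -[in RHS]mulnb natrM; congr (_ * _).
have [/andP[/eqP-> /eqP->]|_] := boolP (axial g).
  by rewrite ![0 == h 0 _]eq_sym !andbF mul1r addr0.
by rewrite mul0r add0r andbT.
Qed.

(** The coordinates form a dual family, so the [abasis g] are free; there are 27 of
    them. *)
Lemma abasis_expand (v : albert F) : v = \sum_g acoord g v *: abasis g.
Proof.
have acoord_comb h (c : G -> F) : acoord h (\sum_g c g *: abasis g) = c h.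
  rewrite acoord_sum (bigD1 h) //= big1 => [|g ne].
    by rewrite acoordZ acoord_abasis eqxx addr0 mulr1.
  by rewrite acoordZ acoord_abasis eq_sym (negPf ne) mulr0.
have cG : #|{: G}| = 27%N by rewrite card_mx card_ord.
have [X XE] : exists X : #|{: G}|.-tuple (albert F),
    forall i : 'I_#|{: G}|, X`_i = abasis (enum_val i).
  by exists [tuple abasis (enum_val i) | i < #|{: G}|] => i; rewrite (nth_mktuple _ _ i).
have sumX (c : 'I_#|{: G}| -> F) :
    \sum_i c i *: X`_i = \sum_g c (enum_rank g) *: abasis g.
  rewrite (reindex _ (onW_bij _ (enum_rank_bij G))) /=; apply: eq_bigr => g _.
  by rewrite XE enum_rankK.
have basX : basis_of fullv X.
  rewrite basisEfree subvf size_tuple dim_albert /=.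
  apply/andP; split; last by rewrite cG.
  apply/freeP => c e0 i; have e := etrans (esym (sumX c)) e0.
  have := acoord_comb (enum_val i) (fun g => c (enum_rank g)).
  by rewrite enum_valK e => <-; rewrite -[0 in LHS](scale0r 0) acoordZ mul0r.
have [c vE] : exists c : G -> F, v = \sum_g c g *: abasis g.
  exists (fun g => coord X (enum_rank g) v).
  by rewrite -(sumX (fun i => coord X i v)) -(coord_basis basX (memvf v)).
rewrite {1}vE; apply: eq_bigr => g _; congr (_ *: _).
by rewrite vE acoord_comb.
Qed.

Lemma abasis_neq0 g : abasis g != 0.
Proof.
apply/eqP => e; have := acoord_abasis g g; rewrite e eqxx.
by move/eqP; rewrite -(scale0r 0) acoordZ mul0r eq_sym oner_eq0.
Qed.

Lemma albert_ext_abasis (phi : 'End(C)) (c : 'Z_3 -> 'Z_3 -> F) g :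
  (forall i j, phi (okb F i j) = c i j *: okb F i j) -> c 0 0 = 1 ->
  albert_ext phi (abasis g) = c (g 0 0) (g 0 1) *: abasis g.
Proof.
move=> phiE c00; rewrite lfunE; congr (_, _).
  apply/rowP => l; rewrite !mxE; case: andP => [[/eqP-> /eqP->]|_].
    by rewrite c00 !mul1r.
  by rewrite !mul0r mulr0.
apply/ffunP => l; rewrite !ffunE iter_ctauZ ctau_cancel linearZ /= phiE !iter_ctauZ.
by rewrite scalerA mulrC -scalerA.
Qed.

Lemma albert_shift_abasis g : albert_shift F (abasis g) = chi (g 0 2%:R) *: abasis g.
Proof.
have e l : chi (- (g 0 2%:R * (l - 1))) = chi (g 0 2%:R) * chi (- (g 0 2%:R * l)).
  by rewrite -chiD //; congr chi; ring.
rewrite lfunE; congr (_, _); first by apply/rowP => l; rewrite !mxE e mulrCA.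
apply/ffunP => l; rewrite !ffunE e ctauZ scalerA; congr (_ *: _).
by elim/ord3P: l => /=; rewrite ?ctau3.
Qed.

Lemma okubo_phi1_okb phi1 : is_okubo_phi1 w phi1 ->
  forall i j, phi1 (okb F i j) = chi i *: okb F i j.
Proof.
move=> phi1P; have w3 := prim_expr_order w_prim.
have [phi [_ uniq_phi]] := okubo_phi1_unique w3.
rewrite -(uniq_phi _ phi1P) (uniq_phi _ (Defs.phi1P w3)) => i j.
rewrite lfunE; elim/ord3P: j; elim/ord3P: i; rewrite /okb /chi ?o3E /=;
  apply: cayleyP => /=; try (apply: ord3P); rewrite ?mxE ?o3E /= ?mxE ?o3E /=;
  rewrite /GRing.scale /= /subn /=; ring: w3.
Qed.

Lemma okubo_phi2_okb phi2 : is_okubo_phi2 w phi2 ->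
  forall i j, phi2 (okb F i j) = chi j *: okb F i j.
Proof.
move=> phi2P; have w3 := prim_expr_order w_prim.
have [phi [_ uniq_phi]] := okubo_phi2_unique w3.
rewrite -(uniq_phi _ phi2P) (uniq_phi _ (Defs.phi2P w3)) => i j.
rewrite lfunE; elim/ord3P: j; elim/ord3P: i; rewrite /okb /chi ?o3E /=;
  apply: cayleyP => /=; try (apply: ord3P); rewrite ?mxE ?o3E /= ?mxE ?o3E /=;
  rewrite /GRing.scale /= /subn /=; ring: w3.
Qed.

(** The vectors [abasis g] are eigenvectors with pairwise distinct triples of
    eigenvalues. *)
Lemma albert_grading_line phi1 phi2 : is_okubo_phi1 w phi1 -> is_okubo_phi2 w phi2 ->
  forall g, albert_grading w phi1 phi2 g = <[abasis g]>%VS.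
Proof.
move=> phi1P phi2P g.
have eigenP (phi : 'End(albert F)) a v : (v \in eigenvspace phi a) = (phi v == a *: v).
  by rewrite memv_ker add_lfunE opp_lfunE scale_lfunE id_lfunE subr_eq0.
have eigen1 := albert_ext_abasis (c := fun i _ => chi i) _ (okubo_phi1_okb phi1P) chi0.
have eigen2 := albert_ext_abasis (c := fun _ j => chi j) _ (okubo_phi2_okb phi2P) chi0.
have eigen3 := albert_shift_abasis.
have coordE (phi : 'End(albert F)) (c : G -> 'Z_3) v h :
    (forall h, phi (abasis h) = chi (c h) *: abasis h) -> phi v = chi (c g) *: v ->
  (acoord h v == 0) || (c h == c g).
  move=> phiE /(congr1 (acoord h)).
  rewrite {1}[v]abasis_expand linear_sum acoord_sum (bigD1 h) //= big1 => [|k ne].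
    rewrite linearZ /= phiE !acoordZ acoord_abasis eqxx addr0 mulr1.
    rewrite mulrC => /eqP; rewrite -subr_eq0 -mulrBl mulf_eq0 orbC subr_eq0.
    by rewrite (inj_eq chi_inj).
  by rewrite linearZ /= phiE !acoordZ acoord_abasis eq_sym (negPf ne) !mulr0.
apply/eqP; rewrite eqEsubv; apply/andP; split; last first.
  rewrite -memvE /albert_grading memv_cap memv_cap.
  by apply/andP; split; first (apply/andP; split); rewrite eigenP; apply/eqP;
    [exact: (eigen1 g) | exact: (eigen2 g) | exact: (eigen3 g)].
apply/subvP => v; rewrite /albert_grading memv_cap memv_cap => /andP[/andP[v1 v2] v3].
have {}v1 := eqP (etrans (esym (eigenP _ _ _)) v1).
have {}v2 := eqP (etrans (esym (eigenP _ _ _)) v2).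
have {}v3 := eqP (etrans (esym (eigenP _ _ _)) v3).
apply/vlineP; exists (acoord g v).
rewrite {1}[v]abasis_expand (bigD1 g) //= big1 ?addr0 // => h ne.
suff /eqP-> : acoord h v == 0 by rewrite scale0r.
apply: contraNT ne => nz; rewrite row3_eqE.
have := coordE _ _ _ h eigen1 v1; rewrite (negPf nz) => /= ->.
have := coordE _ _ _ h eigen2 v2; rewrite (negPf nz) => /= ->.
by have := coordE _ _ _ h eigen3 v3; rewrite (negPf nz) => /= ->.
Qed.

End HomogeneousBasis.

(** * The cocycle of the multiplication table *)

Lemma three_eq0 : 3%:R = 0 :> 'Z_3. Proof. exact: val_inj. Qed.

Lemma det3E (R : comNzRingType) (M : 'M[R]_3) : \det M =
  M 0 0 * (M 1 1 * M 2%:R 2%:R - M 1 2%:R * M 2%:R 1)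
  - M 0 1 * (M 1 0 * M 2%:R 2%:R - M 1 2%:R * M 2%:R 0)
  + M 0 2%:R * (M 1 0 * M 2%:R 1 - M 1 1 * M 2%:R 0).
Proof.
rewrite (expand_det_row _ 0) sum3 /cofactor !(expand_det_row _ 0) !big_ord_recl !big_ord0.
rewrite /cofactor !det_mx11 !mxE.
pose N i j := M (inord i) (inord j).
have ME (i j : 'I_3) : M i j = N i j by rewrite /N !inord_val.
by rewrite !ME /= /bump /=; ring.
Qed.

Lemma mulmx3E (g : G) (M : 'M['Z_3]_3) j :
  (g *m M) 0 j = g 0 0 * M 0 j + g 0 1 * M 1 j + g 0 2%:R * M 2%:R j.
Proof. by rewrite mxE sum3. Qed.

(** The 2-cocycle that has to be a coboundary for [M] to lift to an automorphism. *)
Definition twist (M : 'M['Z_3]_3) (g h : G) := psi (g *m M) (h *m M) - psi g h.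

Definition psi_coord (a0 a1 a2 b0 b1 b2 : 'Z_3) := (a0 * b1 - a1 * b0) * (a2 - b2).
Definition twist_coord (M : 'M['Z_3]_3) (a0 a1 a2 b0 b1 b2 : 'Z_3) :=
  let a j := a0 * M 0 j + a1 * M 1 j + a2 * M 2%:R j in
  let b j := b0 * M 0 j + b1 * M 1 j + b2 * M 2%:R j in
  psi_coord (a 0) (a 1) (a 2%:R) (b 0) (b 1) (b 2%:R) - psi_coord a0 a1 a2 b0 b1 b2.

Lemma twistE M g h : twist M g h =
  twist_coord M (g 0 0) (g 0 1) (g 0 2%:R) (h 0 0) (h 0 1) (h 0 2%:R).
Proof. by rewrite /twist /psi !mulmx3E. Qed.

(** The cocycle is symmetric and trivial on cyclic subgroups, so it splits.  The
    function [f] comes from lifting the three basis vectors arbitrarily and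
    multiplying the lifts of the coordinates in order:
    [(g_1 e_1) (g_2 e_2)], and then [(g_1 e_1 + g_2 e_2) (g_3 e_3)]. *)
Lemma twist_coboundary (M : 'M['Z_3]_3) : \det M = 1 ->
  exists f : G -> 'Z_3, forall g h, twist M g h = f (g + h) - f g - f h.
Proof.
rewrite det3E => detM.
exists (fun g => twist_coord M (g 0 0) 0 0 0 (g 0 1) 0
               + twist_coord M (g 0 0) (g 0 1) 0 0 0 (g 0 2%:R)) => g h.
rewrite twistE ![(g + h) 0 _]mxE /twist_coord /psi_coord.
move: (g 0 0) (g 0 1) (g 0 2%:R) (h 0 0) (h 0 1) (h 0 2%:R) => a0 a1 a2 b0 b1 b2.
move: (M 0 0) (M 0 1) (M 0 2%:R) (M 1 0) (M 1 1) (M 1 2%:R)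
  (M 2%:R 0) (M 2%:R 1) (M 2%:R 2%:R) detM => m00 m01 m02 m10 m11 m12 m20 m21 m22 detM.
have m3 : m00 * m11 * m22 = 1 + m00 * m12 * m21 + m01 * m10 * m22
    - m01 * m12 * m20 - m02 * m10 * m21 + m02 * m11 * m20.
  by rewrite -detM; ring.
(* The two sides differ by [3 q] after the elimination [m3] of m00 m11 m22. *)
pose q := (m11 * m20 - m10 * m21) * (m22 * a2 * b2 * (a1 + b1) - m12 * a1 * b1 * (a2 + b2)
     - m02 * (a1 * b0 * b2 + a0 * a2 * b1))
  + (m01 * m20 - m00 * m21) * (m22 * a2 * b2 * (a0 + b0)
     - m12 * (a1 * a2 * b0 + a0 * b1 * b2) - m02 * a0 * b0 * (a2 + b2))
  + (m01 * m10 - m00 * m11) * (m12 * a1 * b1 * (a0 + b0) - m02 * a0 * b0 * (a1 + b1)).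
rewrite -[LHS]addr0 -[X in _ + X = _](mul0r q) -[X in _ + X * q = _]three_eq0 /q.
ring: m3.
Qed.

(** The left side is minus the coboundary of [psi], which measures associativity.
    Over the integers it differs from the expansion of the determinant along the
    last column by a multiple of 3. *)
Lemma psi_assoc_defect (M : 'M['Z_3]_3) :
  let r i := row i M in
  psi (r 0) (r 1) + psi (r 0 + r 1) (r 2%:R)
  - (psi (r 1) (r 2%:R) + psi (r 0) (r 1 + r 2%:R)) = \det M.
Proof.
rewrite /psi !mxE -[RHS]addr0.
rewrite -[X in _ = _ + X](mul0r (M 1 2%:R * (M 0 0 * M 2%:R 1 - M 0 1 * M 2%:R 0))).
rewrite -[X in _ = _ + X * _]three_eq0 det3E.
move: (M 0 0) (M 0 1) (M 0 2%:R) (M 1 0) (M 1 1) (M 1 2%:R)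
  (M 2%:R 0) (M 2%:R 1) (M 2%:R 2%:R) => *.
ring.
Qed.

(** * Monomial automorphisms and the Weyl group *)

#[local] Arguments albert_mul : simpl never.
#[local] Arguments abasis : simpl never.

Section Weyl.
Variables (F : fieldType) (w : F).
Hypothesis w_prim : 3.-primitive_root w.
Hypothesis two_neq0 : 2%:R != 0 :> F.
Local Notation chi := (chi w).
Local Notation astruct := (astruct w).
Local Notation abasis := (abasis w).
Local Notation acoord := (acoord w).
Local Notation mul := (@albert_mul F).
Local Notation Gam := (fun g => <[abasis g]>%VS).

Lemma dependent_mulmx (M : 'M['Z_3]_3) g h : injective (fun x : G => x *m M) ->
  dependent (g *m M) (h *m M) = dependent g h.
Proof.
move=> M_inj; have eqM (x y : G) : (x *m M == y *m M) = (x == y).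
  exact: (inj_eq M_inj x y).
have eq0 (x : G) : (x *m M == 0) = (x == 0) by rewrite -(eqM x 0) mul0mx.
by rewrite /dependent -mulNmx !eqM !eq0.
Qed.

Lemma astruct_neq0 g h : astruct g h != 0.
Proof.
rewrite mulf_neq0 ?chi_neq0 //; case: dependent; first exact: oner_neq0.
by rewrite oppr_eq0 invr_eq0.
Qed.

Lemma line_inj g h : <[abasis g]>%VS = <[abasis h]>%VS -> g = h.
Proof.
move=> e; have /vlineP[k ek] : abasis g \in <[abasis h]>%VS by rewrite -e memv_line.
have := acoord_abasis w_prim g g; rewrite ek acoordZ acoord_abasis // eqxx => /eqP.
by case: (g =P h) => // _; rewrite mulr0 eq_sym oner_eq0.
Qed.

Lemma grading_supp : gr_supp Gam = setT.
Proof.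
by apply/setP => g; rewrite !inE -dimv_eq0 dim_vline abasis_neq0.
Qed.

(** All components are lines. *)
Lemma gr_aut_monomial phi : gr_aut mul Gam phi ->
  exists u : G -> G, exists lam : G -> F,
    forall g, lam g != 0 /\ phi (abasis g) = lam g *: abasis (u g).
Proof.
case=> [[ker0 _] permG _].
have uP g : exists h, (phi @: <[abasis g]>)%VS = <[abasis h]>%VS.
  by have [|h _ e] := permG g; [rewrite grading_supp | exists h].
have lamP g : exists hk : G * F, hk.2 != 0 /\ phi (abasis g) = hk.2 *: abasis hk.1.
  have [h e] := uP g; have /vlineP[k ek] : phi (abasis g) \in <[abasis h]>%VS.
    by rewrite -e limg_line memv_line.
  exists (h, k); split => //=; apply: contraTneq (abasis_neq0 w_prim g) => k0.
  rewrite negbK -memv0 -ker0 memv_ker ek k0 scale0r //.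
have [f fP] := boolp.choice lamP.
by exists (fun g => (f g).1); exists (fun g => (f g).2).
Qed.

Lemma albert_mulZ k l (X Y : albert F) : mul (k *: X) (l *: Y) = (k * l) *: mul X Y.
Proof.
have Zl (a : F) (U V : albert F) : mul (a *: U) V = a *: mul U V.
  exact: (scale_of_linear (albert_mul_linearl two_neq0 V)).
by rewrite Zl (albert_mulC two_neq0 X) Zl (albert_mulC two_neq0 Y) scalerA.
Qed.

(** Comparing degrees in [phi (X_g X_h) = phi X_g * phi X_h] gives additivity,
    because no structure constant vanishes; comparing coefficients gives the
    relation between the scalars. *)
Lemma monomial_scalars phi (u : G -> G) (lam : G -> F) : alg_aut mul phi ->
    (forall g, lam g != 0 /\ phi (abasis g) = lam g *: abasis (u g)) ->
  [/\ injective u, {morph u : g h / g + h} &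
    forall g h, lam g * lam h * astruct (u g) (u h) = astruct g h * lam (g + h)].
Proof.
case=> /eqP/lker0P phi_inj phiM phiE.
have prodE g h : (lam g * lam h * astruct (u g) (u h)) *: abasis (u g + u h) =
    (astruct g h * lam (g + h)) *: abasis (u (g + h)).
  have l : phi (mul (abasis g) (abasis h)) =
      (astruct g h * lam (g + h)) *: abasis (u (g + h)).
    by rewrite abasis_mul // linearZ /= (proj2 (phiE _)) scalerA.
  have r : mul (phi (abasis g)) (phi (abasis h)) =
      (lam g * lam h * astruct (u g) (u h)) *: abasis (u g + u h).
    rewrite (proj2 (phiE g)) (proj2 (phiE h)) albert_mulZ (abasis_mul w_prim two_neq0).
    by rewrite scalerA.
  by rewrite -l -r phiM.
have uD : {morph u : g h / g + h}.
  move=> g h; have := congr1 (acoord (u g + u h)) (prodE g h).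
  rewrite !acoordZ !acoord_abasis // eqxx mulr1; case: eqP => [-> // | _].
  rewrite mulr0 => e0; have : lam g * lam h * astruct (u g) (u h) != 0.
    rewrite mulf_neq0 ?astruct_neq0 //.
    by rewrite mulf_neq0 // ?(proj1 (phiE g)) ?(proj1 (phiE h)).
  by rewrite e0 eqxx.
split=> // [g h e | g h].
  have e2 : lam h *: abasis g = lam g *: abasis h.
    by apply: phi_inj; rewrite !linearZ /= !(proj2 (phiE _)) e !scalerA mulrC.
  have := congr1 (acoord g) e2; rewrite !acoordZ !acoord_abasis // eqxx mulr1.
  by case: eqP => // _ /eqP; rewrite mulr0 (negPf (proj1 (phiE _))).
have dg c : acoord (u g + u h) (c *: abasis (u g + u h)) = c.
  by rewrite acoordZ acoord_abasis // eqxx mulr1.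
by rewrite -[LHS]dg -[RHS]dg prodE uD.
Qed.

(** The rows of [M] are independent, so all four products have the factor -1/2, and
    only the exponents are left to compare. *)
Lemma astruct_assoc (M : 'M['Z_3]_3) (r := fun i => row i M) :
  injective (fun x : G => x *m M) ->
  astruct (r 0) (r 1) * astruct (r 0 + r 1) (r 2%:R) =
  chi (\det M) * (astruct (r 1) (r 2%:R) * astruct (r 0) (r 1 + r 2%:R)).
Proof.
move=> M_inj; rewrite /astruct -psi_assoc_defect -/(r 0) -/(r 1) -/(r 2%:R).
have dependentE (x y : G) : dependent (x *m M) (y *m M) = dependent x y.
  exact: dependent_mulmx.
rewrite /r !rowE -!mulmxDl !dependentE.
have [-> -> -> ->] : [/\ dependent (delta_mx 0 0) (delta_mx 0 1) = false,
    dependent (delta_mx 0 0 + delta_mx 0 1) (delta_mx 0 2%:R) = false,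
    dependent (delta_mx 0 1) (delta_mx 0 2%:R) = false &
    dependent (delta_mx 0 0) (delta_mx 0 1 + delta_mx 0 2%:R) = false].
  by split; rewrite /dependent !row3_eqE !mxE.
rewrite /=; move: (psi _ _) (psi _ _) (psi _ _) (psi _ _) (- 2%:R^-1) => q' p' q p t.
have e : chi p * chi q = chi (p + q - (q' + p')) * (chi q' * chi p').
  by rewrite -!chiD // subrK.
by rewrite [LHS]mulrACA e [p' + _]addrC; ring.
Qed.

(** The scalars of a monomial map cancel when two bracketings of a product of three
    basis vectors are compared. *)
Lemma assoc_scalars (a b c d a' b' c' d' l0 l1 l2 l01 l12 l012 x x' : F) :
  a != 0 -> b != 0 -> l012 != 0 ->
  l1 * l2 * a' = a * l12 -> l0 * l12 * b' = b * l012 ->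
  l0 * l1 * c' = c * l01 -> l01 * l2 * d' = d * l012 ->
  c * d = x * (a * b) -> c' * d' = x' * (a' * b') -> x' = x.
Proof.
move=> a0 b0 l0' ha hb hc hd hx hx'.
have ab : l0 * l1 * l2 * (a' * b') = a * b * l012.
  transitivity (l0 * b' * (l1 * l2 * a')); first ring.
  by rewrite ha; transitivity (a * (l0 * l12 * b')); [ring | rewrite hb; ring].
have cd : l0 * l1 * l2 * (c' * d') = c * d * l012.
  transitivity (l2 * d' * (l0 * l1 * c')); first ring.
  by rewrite hc; transitivity (c * (l01 * l2 * d')); [ring | rewrite hd; ring].
apply: (mulIf (mulf_neq0 (mulf_neq0 a0 b0) l0')).
by rewrite -{1}ab mulrCA -hx' cd hx !mulrA.
Qed.

(** Apply [astruct_assoc] to the standard basis and to its image. *)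
Lemma monomial_det (M : 'M['Z_3]_3) (lam : G -> F) :
  injective (fun x : G => x *m M) -> (forall g, lam g != 0) ->
  (forall g h, lam g * lam h * astruct (g *m M) (h *m M) = astruct g h * lam (g + h)) ->
  \det M = 1.
Proof.
move=> M_inj lam0 lamE; apply: (chi_inj w_prim).
pose e i : G := row i 1%:M.
have eM i : row i M = e i *m M by rewrite -row_mul mul1mx.
have M1_inj : injective (fun x : G => x *m 1%:M) by move=> x y; rewrite !mulmx1.
have := astruct_assoc M_inj; have := astruct_assoc M1_inj.
rewrite det1 !eM -!mulmxDl -/(e 0) -/(e 1) -/(e 2%:R).
have := lamE (e 0) (e 1 + e 2%:R); rewrite addrA => hb.
exact: assoc_scalars (astruct_neq0 _ _) (astruct_neq0 _ _) (lam0 _)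
  (lamE _ _) hb (lamE _ _) (lamE _ _).
Qed.

Lemma linear_eq_abasis (f1 f2 : albert F -> albert F) : linear f1 -> linear f2 ->
  (forall g, f1 (abasis g) = f2 (abasis g)) -> f1 =1 f2.
Proof.
move=> lin1 lin2 e v; rewrite [v](abasis_expand w_prim).
rewrite (sum_of_linear lin1) (sum_of_linear lin2); apply: eq_bigr => g _.
by rewrite (scale_of_linear lin1) (scale_of_linear lin2) e.
Qed.

Lemma mul_morph_abasis (phi : 'End(albert F)) :
  (forall g h, phi (mul (abasis g) (abasis h)) = mul (phi (abasis g)) (phi (abasis h))) ->
  forall x y, phi (mul x y) = mul (phi x) (phi y).
Proof.
move=> phiM.
have lin1 y : linear (fun x => phi (mul x y)).
  by move=> k x x'; rewrite (albert_mul_linearl two_neq0 y k x x') linearP.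
have lin2 y : linear (fun x => mul (phi x) y).
  by move=> k x x'; rewrite linearP; apply: albert_mul_linearl.
have phiMr x h : phi (mul x (abasis h)) = mul (phi x) (phi (abasis h)).
  exact: (linear_eq_abasis (lin1 (abasis h)) (lin2 (phi (abasis h)))).
move=> x y; rewrite (albert_mulC two_neq0 x) (albert_mulC two_neq0 (phi x)).
apply: (linear_eq_abasis (lin1 x) (lin2 (phi x))) => g.
by rewrite (albert_mulC two_neq0 _ x) phiMr; apply: albert_mulC.
Qed.

(** The scalars are [w ^ f], where [twist M] is the coboundary of [f]. *)
Lemma monomial_lift (M : 'M['Z_3]_3) : \det M = 1 -> injective (fun x : G => x *m M) ->
  exists2 phi, alg_aut mul phi &
    forall g, exists2 k, k != 0 & phi (abasis g) = k *: abasis (g *m M).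
Proof.
move=> /twist_coboundary[f fE] M_inj.
pose lam g := chi (f g).
have lamE g h : lam g * lam h * astruct (g *m M) (h *m M) = astruct g h * lam (g + h).
  rewrite /lam /astruct dependent_mulmx // mulrA [RHS]mulrAC -!chiD //; congr (chi _ * _).
  by rewrite -[psi (_ *m _) _](subrK (psi g h)) -/(twist M g h) fE; ring.
pose phif v : albert F := \sum_g (acoord g v * lam g) *: abasis (g *m M).
have phif_lin : linear phif.
  move=> k v v'; rewrite /phif scaler_sumr -big_split; apply: eq_bigr => g _ /=.
  by rewrite acoordP mulrDl scalerDl -mulrA scalerA.
pose phifM := GRing.isLinear.Build _ _ _ _ phif phif_lin.
pose phiL : {linear albert F -> albert F} := HB.pack phif phifM.
pose phi := linfun phiL.
have phiE v : phi v = \sum_g (acoord g v * lam g) *: abasis (g *m M) by rewrite lfunE.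
have phi_abasis g : phi (abasis g) = lam g *: abasis (g *m M).
  rewrite phiE (bigD1 g) //= acoord_abasis // eqxx mul1r big1 ?addr0 // => h ne.
  by rewrite acoord_abasis // (negPf ne) mul0r scale0r.
exists phi; last by move=> g; exists (lam g); rewrite ?chi_neq0 ?phi_abasis.
split.
  apply/eqP; rewrite -subv0; apply/subvP => v; rewrite memv_ker memv0 => /eqP phi0.
  rewrite [v](abasis_expand w_prim) big1 // => g _.
  have : acoord (g *m M) (phi v) = 0 by rewrite phi0 -(scale0r 0) acoordZ mul0r.
  rewrite phiE acoord_sum (bigD1 g) //= big1 => [|h ne].
    rewrite acoordZ acoord_abasis // eqxx mulr1 addr0 => /eqP.
    rewrite mulf_eq0 (negPf (chi_neq0 _ _)) // orbF.
    by move/eqP->; rewrite scale0r.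
  by rewrite acoordZ acoord_abasis // (inj_eq M_inj) eq_sym (negPf ne) mulr0.
apply: mul_morph_abasis => g h.
rewrite !phi_abasis albert_mulZ !abasis_mul // linearZ /= phi_abasis !scalerA.
by rewrite lamE mulmxDl.
Qed.

Lemma line_scale (k : F) (v : albert F) : k != 0 -> <[k *: v]>%VS = <[v]>%VS.
Proof.
move=> k0; apply/eqP; rewrite eqEsubv -!memvE memvZ ?memv_line //=.
by rewrite -[X in X \in _](scalerK k0) memvZ ?memv_line.
Qed.

Lemma monomial_induces (phi : 'End(albert F)) (u : {perm G}) :
  (forall g, exists2 k, k != 0 & phi (abasis g) = k *: abasis (u g)) -> induces Gam phi u.
Proof.
by move=> phiE g _; have [k k0 e] := phiE g; rewrite limg_line e line_scale.
Qed.

Lemma induces_gr_aut phi (u : {perm G}) :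
  alg_aut mul phi -> induces Gam phi u -> gr_aut mul Gam phi.
Proof.
move=> autphi ind; split=> // g _.
  by exists (u g); [rewrite grading_supp | rewrite ind // grading_supp].
by exists (u^-1%g g); [rewrite grading_supp | rewrite ind ?grading_supp // permKV].
Qed.

Lemma gr_aut_induces phi : gr_aut mul Gam phi ->
  exists2 M : {'GL_3['F_3]}, \det (GLval M) = 1 & induces Gam phi (gperm M).
Proof.
move=> autphi; have [u [lam phiE]] := gr_aut_monomial autphi.
have [aut _ _] := autphi; have [u_inj uD lamE] := monomial_scalars aut phiE.
have : perm u_inj \in Aut [set: G].
  by apply/Aut_G_additive => g h; rewrite !permE uD.
rewrite Aut_G => /imsetP[M _ uM]; exists M.
  have ME g : u g = g *m mx_of_GL M by rewrite -gpermE -uM permE.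
  apply: (monomial_det (lam := lam) (@mx_of_GL_inj M)) => [g | g h].
    exact: (proj1 (phiE g)).
  by rewrite -!ME lamE.
apply: monomial_induces => g; have [k0 e] := phiE g.
by exists (lam g); rewrite // -uM permE.
Qed.

Lemma induces_inj phi (u v : {perm G}) : induces Gam phi u -> induces Gam phi v -> u = v.
Proof.
move=> indu indv; apply/permP => g; apply: line_inj.
by rewrite -indu ?grading_supp // -indv ?grading_supp.
Qed.

Lemma weyl_SL : weyl mul Gam = gperm @: SL3_3.
Proof.
apply/setP => u; rewrite inE; apply/andP/imsetP.
  case=> _ /asboolP[phi autphi indu].
  have [M detM indM] := gr_aut_induces autphi.
  by exists M; [rewrite inE detM | apply: induces_inj indu indM].
case=> M; rewrite inE => /eqP detM ->; split.
  by rewrite Aut_G imset_f // inE.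
apply/asboolP; have [phi aut phiE] := monomial_lift detM (@mx_of_GL_inj M).
have ind : induces Gam phi (gperm M).
  by apply: monomial_induces => g; rewrite gpermE; apply: phiE.
by exists phi => //; apply: induces_gr_aut ind.
Qed.

End Weyl.

Theorem theorem4p8 (F : closedFieldType)
    (char_ne2 : 2%N \notin [pchar F]) (char_ne3 : 3%N \notin [pchar F])
    (w : F) (w_prim : 3.-primitive_root w)
    (phi1 phi2 : 'End(cayley F))
    (phi1P : is_okubo_phi1 w phi1) (phi2P : is_okubo_phi2 w phi2) :
  let Gam := albert_grading w phi1 phi2 in
  let W := weyl (@albert_mul F) Gam in
  [/\ forall phi : 'End(albert F), gr_aut (@albert_mul F) Gam phi ->
        exists! u : {perm 'rV['Z_3]_3},
          u \in Aut [set: 'rV['Z_3]_3] /\ induces Gam phi u,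
      W = ((Aut [set: 'rV['Z_3]_3])^`(1))%g
    & (W \isog SL3_3)%g].
Proof.
have two_neq0 : 2%:R != 0 :> F by move: char_ne2; rewrite inE.
have -> : albert_grading w phi1 phi2 = fun g => <[abasis w g]>%VS.
  by apply: boolp.funext => g; apply: albert_grading_line.
move=> Gam W; have WE : W = gperm @: SL3_3 by apply: weyl_SL.
have subT (A : {set {'GL_3['F_3]}}) : A \subset [set: {'GL_3['F_3]}] by apply: subsetT.
have imE (A : {set {'GL_3['F_3]}}) : gperm @: A = (gperm @* A)%g by rewrite morphimEsub.
have SLE : SL3_3 = ([set: {'GL_3['F_3]}]^`(1))%g by apply: (@SL_der1 'F_3 2).
split.
- move=> phi autphi; have [M _ indM] := gr_aut_induces w_prim two_neq0 autphi.
  exists (gperm M); split; first by rewrite Aut_G imset_f // inE.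
  by move=> v [_ indv]; apply: induces_inj indM indv.
- by rewrite WE Aut_G !imE SLE morphim_der.
- rewrite WE imE SLE isog_sym; apply: sub_isog gperm_inj; exact: subsetT.
Qed.
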